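(* Let $M$ be a structure and $A \subseteq M$ such that $(M,\Delta^0_1\text{-}\mathrm{Def}(M,A)) \vDash \mathrm{RCA}_0^*$. Then $(M,\Delta^0_1\text{-}\mathrm{Def}(M,A)) \vDash \neg \mathrm{COH}$.
   Context: $\mathrm{RCA}_0^*$ is $\mathrm{RCA}_0$ with $\Sigma^0_1$-induction replaced by $\Delta^0_0$-induction plus the axiom $\exp$. $\Delta^0_1\text{-}\mathrm{Def}(M,A)$ is the family of subsets of $M$ that are $\Delta_1$-definable in $(M,A)$ with parameters from $M$. A set $C$ is cohesive for a sequence $(R_n)_{n\in\mathbb{N}}$ of subsets of $\mathbb{N}$ if for each $n$, either all but finitely many elements of $C$ are in $R_n$ or all but finitely many are in $\mathbb{N}\setminus R_n$. $\mathrm{COH}$: every sequence $(R_n)_{n\in\mathbb{N}}$ of subsets of $\mathbb{N}$ has an unbounded (containing elements above every number) cohesive set. *)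

(* Defs.v *)
(** Syntax and semantics of second-order arithmetic, with de Bruijn indices.
    Number variables and set variables are indexed independently: a number
    quantifier shifts only the former, a set quantifier only the latter. *)

Inductive term : Type :=
| Var (n : nat)
| Zero
| One
| Add (t u : term)
| Mul (t u : term).

Inductive formula : Type :=
| Eq (t u : term)
| Lt (t u : term)
| Mem (t : term) (X : nat)
| Neg (p : formula)
| And (p q : formula)
| Or (p q : formula)
| Imp (p q : formula)
| All (p : formula)
| Ex (p : formula)
| AllS (p : formula)
| ExS (p : formula).

Definition Iff (p q : formula) : formula := And (Imp p q) (Imp q p).

Declare Scope L2_scope.
Delimit Scope L2_scope with L2.
Bind Scope L2_scope with term formula.

Notation "# n" := (Var n%nat) (at level 1, n at level 0, format "# n") : L2_scope.
Notation "0" := Zero : L2_scope.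
Notation "1" := One : L2_scope.
Notation "t + u" := (Add t u) : L2_scope.
Notation "t * u" := (Mul t u) : L2_scope.
Notation "t == u" := (Eq t u) (at level 70, no associativity) : L2_scope.
Notation "t < u" := (Lt t u) : L2_scope.
Notation "t \in X" := (Mem t X%nat) (at level 70, no associativity) : L2_scope.
Notation "~ p" := (Neg p) : L2_scope.
Notation "p /\ q" := (And p q) : L2_scope.
Notation "p \/ q" := (Or p q) : L2_scope.
Notation "p -> q" := (Imp p q) : L2_scope.
Notation "p <-> q" := (Iff p q) : L2_scope.

Definition scons {T : Type} (a : T) (s : nat -> T) (n : nat) : T :=
  match n with O => a | S k => s k end.

Fixpoint tsubst (s : nat -> term) (t : term) : term :=
  match t with
  | Var n => s n
  | Zero => Zero
  | One => One
  | Add t u => Add (tsubst s t) (tsubst s u)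
  | Mul t u => Mul (tsubst s t) (tsubst s u)
  end.

Definition tlift (t : term) : term := tsubst (fun n => Var (S n)) t.

Definition up (s : nat -> term) : nat -> term :=
  scons (Var O) (fun n => tlift (s n)).

Fixpoint subst (s : nat -> term) (p : formula) : formula :=
  match p with
  | Eq t u => Eq (tsubst s t) (tsubst s u)
  | Lt t u => Lt (tsubst s t) (tsubst s u)
  | Mem t X => Mem (tsubst s t) X
  | Neg p => Neg (subst s p)
  | And p q => And (subst s p) (subst s q)
  | Or p q => Or (subst s p) (subst s q)
  | Imp p q => Imp (subst s p) (subst s q)
  | All p => All (subst (up s) p)
  | Ex p => Ex (subst (up s) p)
  | AllS p => AllS (subst s p)
  | ExS p => ExS (subst s p)
  end.

Fixpoint set_rename (r : nat -> nat) (p : formula) : formula :=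
  match p with
  | Eq t u => Eq t u
  | Lt t u => Lt t u
  | Mem t X => Mem t (r X)
  | Neg p => Neg (set_rename r p)
  | And p q => And (set_rename r p) (set_rename r q)
  | Or p q => Or (set_rename r p) (set_rename r q)
  | Imp p q => Imp (set_rename r p) (set_rename r q)
  | All p => All (set_rename r p)
  | Ex p => Ex (set_rename r p)
  | AllS p => AllS (set_rename (scons O (fun n => S (r n))) p)
  | ExS p => ExS (set_rename (scons O (fun n => S (r n))) p)
  end.

Definition set_lift (p : formula) : formula := set_rename S p.

(** The lift of [t] ensures that a bound does not mention the variable that it
    bounds. *)
Inductive Delta00 : formula -> Prop :=
| Delta00_Eq t u : Delta00 (Eq t u)
| Delta00_Lt t u : Delta00 (Lt t u)
| Delta00_Mem t X : Delta00 (Mem t X)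
| Delta00_Neg p : Delta00 p -> Delta00 (Neg p)
| Delta00_And p q : Delta00 p -> Delta00 q -> Delta00 (And p q)
| Delta00_Or p q : Delta00 p -> Delta00 q -> Delta00 (Or p q)
| Delta00_Imp p q : Delta00 p -> Delta00 q -> Delta00 (Imp p q)
| Delta00_All t p : Delta00 p -> Delta00 (All (#0 < tlift t -> p))
| Delta00_Ex t p : Delta00 p -> Delta00 (Ex (#0 < tlift t /\ p)).

Inductive Sigma01 : formula -> Prop :=
| Sigma01_Ex p : Delta00 p -> Sigma01 (Ex p).

Inductive Pi01 : formula -> Prop :=
| Pi01_All p : Delta00 p -> Pi01 (All p).

Record L1_structure : Type := {
  carrier :> Type;
  zero : carrier;
  one : carrier;
  add : carrier -> carrier -> carrier;
  mul : carrier -> carrier -> carrier;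
  lt : carrier -> carrier -> Prop
}.

Arguments zero {_}.
Arguments one {_}.
Arguments add {_} _ _.
Arguments mul {_} _ _.
Arguments lt {_} _ _.

Record L2_structure : Type := Model {
  numbers :> L1_structure;
  sets : (numbers -> Prop) -> Prop
}.

Fixpoint eval (M : L1_structure) (rho : nat -> M) (t : term) : M :=
  match t with
  | Var n => rho n
  | Zero => zero
  | One => one
  | Add t u => add (eval M rho t) (eval M rho u)
  | Mul t u => mul (eval M rho t) (eval M rho u)
  end.

Fixpoint sat (N : L2_structure) (rho : nat -> N) (sigma : nat -> N -> Prop)
    (p : formula) : Prop :=
  match p with
  | Eq t u => eval N rho t = eval N rho u
  | Lt t u => lt (eval N rho t) (eval N rho u)
  | Mem t X => sigma X (eval N rho t)
  | Neg p => ~ sat N rho sigma p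
  | And p q => sat N rho sigma p /\ sat N rho sigma q
  | Or p q => sat N rho sigma p \/ sat N rho sigma q
  | Imp p q => sat N rho sigma p -> sat N rho sigma q
  | All p => forall a : N, sat N (scons a rho) sigma p
  | Ex p => exists a : N, sat N (scons a rho) sigma p
  | AllS p => forall X : N -> Prop, sets N X -> sat N rho (scons X sigma) p
  | ExS p => exists X : N -> Prop, sets N X /\ sat N rho (scons X sigma) p
  end.

(** Truth of the universal closure. *)
Definition models (N : L2_structure) (p : formula) : Prop :=
  forall (rho : nat -> N) (sigma : nat -> N -> Prop),
    (forall i, sets N (sigma i)) -> sat N rho sigma p.

Definition models_theory (N : L2_structure) (T : formula -> Prop) : Prop :=
  forall p, T p -> models N p.

(** Goedel's beta function: [r] is the remainder of [a] modulo
    [1 + (i + 1) * b]. *)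
Definition beta (a b i r : term) : formula :=
  (r < 1 + (i + 1) * b /\
   Ex (tlift a == #0 * (1 + (tlift i + 1) * tlift b) + tlift r))%L2.

(** [y = 2 ^ x], witnessed by a beta-code ([#1] and [#0] after the two
    existential quantifiers) of the sequence 1, 2, 4, up to
    2 ^ x.  Over bounded induction, totality of this graph is equivalent to
    totality of any of the usual bounded definitions of exponentiation. *)
Definition power2 (x y : term) : formula :=
  (Ex (Ex (beta #1 #0 0 1 /\
           All (#0 < tlift (tlift (tlift x)) ->
                Ex (beta #3 #2 #1 #0 /\ beta #3 #2 (#1 + 1) (#0 + #0))) /\
           beta #1 #0 (tlift (tlift x)) (tlift (tlift y)))))%L2.

Definition exp_axiom : formula := All (Ex (power2 #1 #0)).

Definition induction (p : formula) : formula :=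
  (subst (scons Zero Var) p /\
   All (p -> subst (scons (#0 + 1) (fun n => Var (S n))) p) ->
   All p)%L2.

(** [set_lift] keeps the comprehended set from occurring in [p]. *)
Definition comprehension (p q : formula) : formula :=
  (All (p <-> q) -> ExS (All (#0 \in 0 <-> set_lift p)))%L2.

Inductive RCA0star : formula -> Prop :=
| ax_succ_neq_0 : RCA0star (~ #0 + 1 == 0)
| ax_succ_inj : RCA0star (#0 + 1 == #1 + 1 -> #0 == #1)
| ax_add_0 : RCA0star (#0 + 0 == #0)
| ax_add_succ : RCA0star (#0 + (#1 + 1) == (#0 + #1) + 1)
| ax_mul_0 : RCA0star (#0 * 0 == 0)
| ax_mul_succ : RCA0star (#0 * (#1 + 1) == #0 * #1 + #0)
| ax_lt_0 : RCA0star (~ #0 < 0)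
| ax_lt_succ : RCA0star (#0 < #1 + 1 <-> #0 < #1 \/ #0 == #1)
| ax_exp : RCA0star exp_axiom
| ax_induction p : Delta00 p -> RCA0star (induction p)
| ax_comprehension p q :
    Sigma01 p -> Pi01 q -> RCA0star (comprehension p q).

Definition pair (t u : term) : term := ((t + u) * (t + u) + t)%L2.

(** A sequence of sets is coded by the single set R = {(n, x) : x in R_n};
    "all but finitely many" means all those above some bound.  In the matrix,
    set variable 1 is the code R and set variable 0 is C. *)
Definition unbounded_cohesive : formula :=
  (All (Ex (#1 < #0 /\ #0 \in 0)) /\
   All (Ex (All (#1 < #0 -> #0 \in 0 -> pair #2 #0 \in 1)) \/
        Ex (All (#1 < #0 -> #0 \in 0 -> ~ pair #2 #0 \in 1))))%L2.

Definition COH : formula := AllS (ExS unbounded_cohesive).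

(** The expansion (M, A) is read as the two-sorted structure whose only set is
    A, so that every set variable denotes A; the values of [rho] are the
    parameters. *)
Definition definable_by (M : L1_structure) (A X : M -> Prop) (rho : nat -> M)
    (p : formula) : Prop :=
  forall x : M, X x <-> sat (Model M (eq A)) (scons x rho) (fun _ => A) p.

Definition Delta01_Def (M : L1_structure) (A : M -> Prop) (X : M -> Prop) : Prop :=
  exists (p q : formula) (rho : nat -> M),
    Sigma01 p /\ Pi01 q /\
    definable_by M A X rho p /\ definable_by M A X rho q.

(* Main.v *)
(** Let C_n be the n-th set enumerable relative to A, parameters being coded in n.
    Put c(n, x) for the largest c < x enumerated into C_n by stage x, and let R_n(x)
    hold iff R_n(c(n, x)) fails.  If C_n is unbounded and R_n is constant on the
    elements of C_n above b, then any c in C_n above b and any large enough x in C_n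
    give b < c(n, x) < x with both c(n, x) and x in C_n, although R_n takes different
    values there; so the sequence (R_n) has no cohesive set that is enumerable
    relative to A.

    Sigma-1 induction is not available, hence the stages and the recursion for R_n
    have to be bounded.  Finite sets are coded by the binary digits of a number, the
    powers of 2 being read off a table provided by exp; bounded-definable finite sets
    and functions defined by recursion with 0-1 values have codes, by bounded
    induction.  The set C_n is enumerated by certificates: coded sets of facts "the
    program c holds at the stack v" each of which follows from others in the set.
    Every bounded formula with parameters compiles to a (standard) program, for which
    certificates are sound by induction on the program and exist by bounded
    comprehension. *)

From Stdlib Require Import Classical FunctionalExtensionality Arith Lia List Ring.
Require Import Defs.

(** * Substitution, and what the truth of a formula depends on *)

Lemma forall_iff {T : Type} (P Q : T -> Prop) :
  (forall x, P x <-> Q x) -> (forall x, P x) <-> (forall x, Q x).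
Proof. firstorder. Qed.

Lemma exists_iff {T : Type} (P Q : T -> Prop) :
  (forall x, P x <-> Q x) -> (exists x, P x) <-> (exists x, Q x).
Proof. firstorder. Qed.

Lemma eval_tsubst (M : L1_structure) (rho : nat -> M) s t :
  eval M rho (tsubst s t) = eval M (fun n => eval M rho (s n)) t.
Proof. induction t; simpl; congruence. Qed.

Lemma eval_tlift (M : L1_structure) (rho : nat -> M) a t :
  eval M (scons a rho) (tlift t) = eval M rho t.
Proof. apply eval_tsubst. Qed.

Lemma eval_up (M : L1_structure) (rho : nat -> M) a s :
  (fun n => eval M (scons a rho) (up s n)) = scons a (fun n => eval M rho (s n)).
Proof.
  extensionality n; destruct n; simpl; [reflexivity | apply eval_tlift].
Qed.

Lemma sat_subst (N : L2_structure) p (rho : nat -> N) sigma s :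
  sat N rho sigma (subst s p) <-> sat N (fun n => eval N rho (s n)) sigma p.
Proof.
  revert rho sigma s.
  induction p; intros rho sigma s; simpl; rewrite ?eval_tsubst; try tauto.
  - rewrite IHp; tauto.
  - rewrite IHp1, IHp2; tauto.
  - rewrite IHp1, IHp2; tauto.
  - rewrite IHp1, IHp2; tauto.
  - apply forall_iff; intro a; rewrite IHp, eval_up; tauto.
  - apply exists_iff; intro a; rewrite IHp, eval_up; tauto.
  - apply forall_iff; intro X; rewrite IHp; tauto.
  - apply exists_iff; intro X; rewrite IHp; tauto.
Qed.

Lemma sat_subst_env (M : L1_structure) S p (rho rho' : nat -> M) sigma s :
  (fun n => eval M rho (s n)) = rho' ->
  sat (Model M S) rho sigma (subst s p) <-> sat (Model M S) rho' sigma p.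
Proof. intros <-; apply (sat_subst (Model M S)). Qed.

Lemma tsubst_up_tlift s t : tsubst (up s) (tlift t) = tlift (tsubst s t).
Proof. unfold tlift; induction t; [reflexivity | simpl in *; congruence ..]. Qed.

Lemma Delta00_subst s p : Delta00 p -> Delta00 (subst s p).
Proof.
  intro H; revert s; induction H; intro s; simpl; rewrite ?tsubst_up_tlift;
    constructor; auto.
Qed.

(** Bounded formulas contain no set quantifiers. This carries truth from the structure whose only
    set is [A] to the one whose sets are the definable ones. *)
Lemma sat_sets_irrelevant (M : L1_structure) S1 S2 p :
  Delta00 p -> forall (rho : nat -> M) sigma,
  sat (Model M S1) rho sigma p <-> sat (Model M S2) rho sigma p.
Proof.
  induction 1; intros rho sigma; simpl in *; try tauto;
    try (rewrite IHDelta00; tauto);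
    try (rewrite IHDelta00_1, IHDelta00_2; tauto).
  - apply forall_iff; intro a; rewrite IHDelta00; tauto.
  - apply exists_iff; intro a; rewrite IHDelta00; tauto.
Qed.

Lemma eval_support (M : L1_structure) t : exists k, forall rho rho' : nat -> M,
  (forall i, i < k -> rho i = rho' i) -> eval M rho t = eval M rho' t.
Proof.
  induction t as [n| | |t [k Hk] u [l Hl]|t [k Hk] u [l Hl]]; simpl.
  - exists (S n); intros rho rho' E; apply E; lia.
  - exists 0; reflexivity.
  - exists 0; reflexivity.
  - exists (k + l); intros rho rho' E; f_equal; [apply Hk|apply Hl]; intros i Hi; apply E; lia.
  - exists (k + l); intros rho rho' E; f_equal; [apply Hk|apply Hl]; intros i Hi; apply E; lia.
Qed.

(** A formula has finitely many free variables, so that the parameters of a definition can later be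
    gathered into one coded list. *)
Lemma sat_support (N : L2_structure) p : exists k, forall (rho rho' : nat -> N) sigma,
  (forall i, i < k -> rho i = rho' i) -> sat N rho sigma p <-> sat N rho' sigma p.
Proof.
  assert (B : forall k a (rho rho' : nat -> N), (forall i, i < k -> rho i = rho' i) ->
    forall i, i < k -> scons a rho i = scons a rho' i)
    by (intros k a rho rho' E [|i] Hi; simpl; auto with arith).
  induction p as [t u|t u|t X|p [k Hk]|p [k Hk] q [l Hl]|p [k Hk] q [l Hl]
    |p [k Hk] q [l Hl]|p [k Hk]|p [k Hk]|p [k Hk]|p [k Hk]]; simpl.
  - destruct (eval_support N t) as [k Hk], (eval_support N u) as [l Hl];
    exists (k + l); intros rho rho' sigma E;
    rewrite (Hk rho rho'), (Hl rho rho') by (intros i Hi; apply E; lia); tauto.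
  - destruct (eval_support N t) as [k Hk], (eval_support N u) as [l Hl];
    exists (k + l); intros rho rho' sigma E;
    rewrite (Hk rho rho'), (Hl rho rho') by (intros i Hi; apply E; lia); tauto.
  - destruct (eval_support N t) as [k Hk]; exists k; intros rho rho' sigma E.
    rewrite (Hk rho rho' E); tauto.
  - exists k; intros rho rho' sigma E; rewrite (Hk rho rho' sigma E); tauto.
  - exists (k + l); intros rho rho' sigma E;
    rewrite (Hk rho rho' sigma), (Hl rho rho' sigma) by (intros i Hi; apply E; lia); tauto.
  - exists (k + l); intros rho rho' sigma E;
    rewrite (Hk rho rho' sigma), (Hl rho rho' sigma) by (intros i Hi; apply E; lia); tauto.
  - exists (k + l); intros rho rho' sigma E;
    rewrite (Hk rho rho' sigma), (Hl rho rho' sigma) by (intros i Hi; apply E; lia); tauto.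
  - exists k; intros rho rho' sigma E; apply forall_iff; intro a; apply Hk, B, E.
  - exists k; intros rho rho' sigma E; apply exists_iff; intro a; apply Hk, B, E.
  - exists k; intros rho rho' sigma E; apply forall_iff; intro X.
    rewrite (Hk rho rho' _ E); tauto.
  - exists k; intros rho rho' sigma E; apply exists_iff; intro X.
    rewrite (Hk rho rho' _ E); tauto.
Qed.

(** Interleaving leaves infinitely many variables both for the arguments of a relation and for its
    parameters. *)
Fixpoint mix {T : Type} (f g : nat -> T) (n : nat) : T :=
  match n with O => f O | S k => mix g (fun i => f (S i)) k end.

Lemma mix_even {T : Type} n : forall f g : nat -> T, mix f g (2 * n) = f n.
Proof.
  induction n; intros f g; [reflexivity|].
  replace (2 * S n) with (S (S (2 * n))) by lia; apply IHn.
Qed.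

Lemma mix_odd {T : Type} n (f g : nat -> T) : mix f g (S (2 * n)) = g n.
Proof. apply mix_even. Qed.

Lemma mix_map {T U : Type} (h : T -> U) n :
  forall f g, h (mix f g n) = mix (fun i => h (f i)) (fun i => h (g i)) n.
Proof. induction n; intros f g; simpl; auto. Qed.

Lemma mix_eval (M : L1_structure) (rho f g : nat -> M) h k :
  (forall n, rho (h n) = f n) -> (forall n, rho (k n) = g n) ->
  (fun n => eval M rho (Var (mix h k n))) = mix f g.
Proof.
  intros Hf Hg; extensionality n; simpl; rewrite (mix_map rho).
  apply functional_extensionality in Hf, Hg; rewrite Hf, Hg; reflexivity.
Qed.

(** * Bounded-definable relations *)

Section DefinableRelations.

Context (M : L1_structure) (A : M -> Prop).

(** Terms with parameters, represented by their values: definability is then proved of a relation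
    itself, without writing out a formula. *)
Inductive isT : ((nat -> M) -> M) -> Prop :=
| T_const a : isT (fun _ => a)
| T_var n : isT (fun rho => rho n)
| T_add f g : isT f -> isT g -> isT (fun rho => add (f rho) (g rho))
| T_mul f g : isT f -> isT g -> isT (fun rho => mul (f rho) (g rho)).

Lemma T_rename f h : isT f -> isT (fun rho => f (fun n => rho (h n))).
Proof. induction 1; constructor; assumption. Qed.

(** The relations [fun rho => P (rho 0) ... (rho k)] that are bounded-definable
    in (M, A) with parameters from M. *)
Inductive isD : ((nat -> M) -> Prop) -> Prop :=
| D_eq f g : isT f -> isT g -> isD (fun rho => f rho = g rho)
| D_lt f g : isT f -> isT g -> isD (fun rho => lt (f rho) (g rho))
| D_mem f : isT f -> isD (fun rho => A (f rho))
| D_not P : isD P -> isD (fun rho => ~ P rho)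
| D_and P Q : isD P -> isD Q -> isD (fun rho => P rho /\ Q rho)
| D_or P Q : isD P -> isD Q -> isD (fun rho => P rho \/ Q rho)
| D_imp P Q : isD P -> isD Q -> isD (fun rho => P rho -> Q rho)
| D_all f (P : (nat -> M) -> M -> Prop) : isT f ->
    isD (fun rho => P (fun n => rho (S n)) (rho 0)) ->
    isD (fun rho => forall x, lt x (f rho) -> P rho x)
| D_ex f (P : (nat -> M) -> M -> Prop) : isT f ->
    isD (fun rho => P (fun n => rho (S n)) (rho 0)) ->
    isD (fun rho => exists x, lt x (f rho) /\ P rho x).

Lemma D_iff P Q : isD P -> isD Q -> isD (fun rho => P rho <-> Q rho).
Proof. intros HP HQ; apply D_and; apply D_imp; assumption. Qed.

Local Notation N := (Model M (eq A)).

(** The even variables hold the arguments [rho], the odd ones the parameters [theta]. *)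
Definition tdef (f : (nat -> M) -> M) (t : term) (theta : nat -> M) : Prop :=
  forall rho, eval M (mix rho theta) t = f rho.

Definition fdef (P : (nat -> M) -> Prop) (p : formula) (theta : nat -> M) : Prop :=
  forall rho, sat N (mix rho theta) (fun _ => A) p <-> P rho.

(** When two formulas are joined, their parameters are interleaved in turn: parameter [n] of the
    left one becomes parameter [2 * n], found at variable [S (2 * (2 * n))], and the arguments stay
    in place. *)
Definition renl (n : nat) : term :=
  Var (mix (fun n => 2 * n) (fun n => S (2 * (2 * n))) n).
Definition renr (n : nat) : term :=
  Var (mix (fun n => 2 * n) (fun n => S (2 * S (2 * n))) n).

Lemma renl_env rho theta1 theta2 :
  (fun n => eval M (mix rho (mix theta1 theta2)) (renl n)) = mix rho theta1.
Proof.
  apply mix_eval; intro n; rewrite ?mix_odd, mix_even; reflexivity.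
Qed.

Lemma renr_env rho theta1 theta2 :
  (fun n => eval M (mix rho (mix theta1 theta2)) (renr n)) = mix rho theta2.
Proof.
  apply mix_eval; intro n; rewrite ?mix_odd, ?mix_even; reflexivity.
Qed.

Lemma tdef_join f g t u theta1 theta2 :
  tdef f t theta1 -> tdef g u theta2 ->
  tdef f (tsubst renl t) (mix theta1 theta2) /\
  tdef g (tsubst renr u) (mix theta1 theta2).
Proof.
  intros Hf Hg; split; intro rho; rewrite eval_tsubst.
  - rewrite renl_env; apply Hf.
  - rewrite renr_env; apply Hg.
Qed.

Lemma fdef_subst P p theta theta' s :
  fdef P p theta ->
  (forall rho, (fun n => eval M (mix rho theta') (s n)) = mix rho theta) ->
  fdef P (subst s p) theta'.
Proof. intros H E rho; rewrite (sat_subst_env _ _ _ _ _ _ _ (E rho)); apply H. Qed.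

Lemma isT_term f : isT f -> exists t theta, tdef f t theta.
Proof.
  induction 1 as [a|n|f g _ [t [th1 Ht]] _ [u [th2 Hu]]|f g _ [t [th1 Ht]] _ [u [th2 Hu]]].
  - exists (Var 1), (fun _ => a); intro rho; reflexivity.
  - exists (Var (2 * n)), (fun _ => zero); intro rho; apply mix_even.
  - destruct (tdef_join _ _ _ _ _ _ Ht Hu) as [Ht' Hu'].
    exists (Add (tsubst renl t) (tsubst renr u)), (mix th1 th2); intro rho; simpl.
    rewrite Ht', Hu'; reflexivity.
  - destruct (tdef_join _ _ _ _ _ _ Ht Hu) as [Ht' Hu'].
    exists (Mul (tsubst renl t) (tsubst renr u)), (mix th1 th2); intro rho; simpl.
    rewrite Ht', Hu'; reflexivity.
Qed.

(** Moves the innermost bound variable from position 0 of [mix] over an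
    extended assignment to the front. *)
Definition renq (n : nat) : term :=
  Var (mix (scons 0 (fun n => S (2 * n))) (fun n => S (S (2 * n))) n).

Lemma renq_env a rho theta :
  (fun n => eval M (scons a (mix rho theta)) (renq n)) = mix (scons a rho) theta.
Proof.
  apply mix_eval; intro n.
  - destruct n; [reflexivity | apply (mix_even n)].
  - apply (mix_odd n).
Qed.

Lemma isD_formula P :
  isD P -> exists p theta, Delta00 p /\ fdef P p theta.
Proof.
  induction 1 as [f g Hf Hg|f g Hf Hg|f Hf|P _ [p [th [Hp H]]]
    |P Q _ [p [th1 [Hp HP]]] _ [q [th2 [Hq HQ]]]
    |P Q _ [p [th1 [Hp HP]]] _ [q [th2 [Hq HQ]]]
    |P Q _ [p [th1 [Hp HP]]] _ [q [th2 [Hq HQ]]]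
    |f P Hf _ [p [th2 [Hp HP]]]|f P Hf _ [p [th2 [Hp HP]]]].
  - destruct (isT_term _ Hf) as [t [th1 Ht]], (isT_term _ Hg) as [u [th2 Hu]].
    destruct (tdef_join _ _ _ _ _ _ Ht Hu) as [Ht' Hu'].
    exists (Eq (tsubst renl t) (tsubst renr u)), (mix th1 th2); split; [constructor|].
    intro rho; simpl; rewrite Ht', Hu'; tauto.
  - destruct (isT_term _ Hf) as [t [th1 Ht]], (isT_term _ Hg) as [u [th2 Hu]].
    destruct (tdef_join _ _ _ _ _ _ Ht Hu) as [Ht' Hu'].
    exists (Lt (tsubst renl t) (tsubst renr u)), (mix th1 th2); split; [constructor|].
    intro rho; simpl; rewrite Ht', Hu'; tauto.
  - destruct (isT_term _ Hf) as [t [th Ht]].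
    exists (Mem t 0), th; split; [constructor|].
    intro rho; simpl; rewrite Ht; tauto.
  - exists (Neg p), th; split; [constructor; auto|].
    intro rho; simpl; rewrite (H rho); tauto.
  - exists (And (subst renl p) (subst renr q)), (mix th1 th2);
      split; [constructor; apply Delta00_subst; assumption|].
    intro rho; simpl; rewrite (fdef_subst _ _ _ _ _ HP (fun r => renl_env r th1 th2) rho),
      (fdef_subst _ _ _ _ _ HQ (fun r => renr_env r th1 th2) rho); tauto.
  - exists (Or (subst renl p) (subst renr q)), (mix th1 th2);
      split; [constructor; apply Delta00_subst; assumption|].
    intro rho; simpl; rewrite (fdef_subst _ _ _ _ _ HP (fun r => renl_env r th1 th2) rho),
      (fdef_subst _ _ _ _ _ HQ (fun r => renr_env r th1 th2) rho); tauto.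
  - exists (Imp (subst renl p) (subst renr q)), (mix th1 th2);
      split; [constructor; apply Delta00_subst; assumption|].
    intro rho; simpl; rewrite (fdef_subst _ _ _ _ _ HP (fun r => renl_env r th1 th2) rho),
      (fdef_subst _ _ _ _ _ HQ (fun r => renr_env r th1 th2) rho); tauto.
  - destruct (isT_term _ Hf) as [t [th1 Ht]].
    eexists _, (mix th1 th2); split.
    + apply (Delta00_All (tsubst renl t)), (Delta00_subst renq), (Delta00_subst renr), Hp.
    + intro rho; simpl; apply forall_iff; intro a.
      rewrite eval_tlift, eval_tsubst, renl_env, (Ht rho),
        (sat_subst_env _ _ _ _ _ _ _ (renq_env a rho _)).
      rewrite (fdef_subst _ _ _ _ _ HP (fun r => renr_env r th1 th2) (scons a rho)).
      simpl; tauto.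
  - destruct (isT_term _ Hf) as [t [th1 Ht]].
    eexists _, (mix th1 th2); split.
    + apply (Delta00_Ex (tsubst renl t)), (Delta00_subst renq), (Delta00_subst renr), Hp.
    + intro rho; simpl; apply exists_iff; intro a.
      rewrite eval_tlift, eval_tsubst, renl_env, (Ht rho),
        (sat_subst_env _ _ _ _ _ _ _ (renq_env a rho _)).
      rewrite (fdef_subst _ _ _ _ _ HP (fun r => renr_env r th1 th2) (scons a rho)).
      simpl; tauto.
Qed.

Lemma isD_sat (P : M -> M -> Prop) :
  isD (fun rho => P (rho 0) (rho 1)) ->
  exists p (rho : nat -> M), Delta00 p /\
    forall w x : M, sat N (scons w (scons x rho)) (fun _ => A) p <-> P w x.
Proof.
  intro H; destruct (isD_formula _ H) as [p [theta [Hp Hdef]]].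
  (* The arguments from position 2 on may take any value; all of them are read from variable 2,
     which holds [theta 0]. *)
  set (r := scons 0 (fun n => match n with O => 1 | S _ => 2 end)).
  exists (subst (fun n => Var (mix r (fun n => S (S n)) n)) p).
  exists theta; split; [apply Delta00_subst, Hp|].
  intros w x.
  rewrite <- (Hdef (scons w (scons x (fun _ => theta 0)))).
  apply sat_subst_env, mix_eval; intro n; [|reflexivity].
  destruct n as [|[|n]]; reflexivity.
Qed.

Lemma isD_Delta01_Def (P Q : M -> M -> Prop) (X : M -> Prop) :
  isD (fun rho => P (rho 0) (rho 1)) -> isD (fun rho => Q (rho 0) (rho 1)) ->
  (forall x, X x <-> exists w, P w x) -> (forall x, X x <-> forall w, Q w x) ->
  Delta01_Def M A X.
Proof.
  intros DP DQ HP HQ.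
  destruct (isD_sat P DP) as [p [th1 [Hp Ep]]], (isD_sat Q DQ) as [q [th2 [Hq Eq]]].
  (* [Delta01_Def] provides one assignment for both formulas: [p] reads the even parameters and [q]
     the odd ones. *)
  exists (Ex (subst (fun n => Var match n with S (S k) => S (S (2 * k)) | _ => n end) p)).
  exists (All (subst (fun n => Var match n with S (S k) => S (S (S (2 * k))) | _ => n end) q)).
  exists (mix th1 th2).
  split; [constructor; apply Delta00_subst, Hp|].
  split; [constructor; apply Delta00_subst, Hq|].
  split; intro x; cbn [sat].
  - rewrite HP; apply exists_iff; intro w; rewrite <- Ep; symmetry; apply sat_subst_env.
    extensionality n; destruct n as [|[|n]]; try reflexivity.
    exact (mix_even n th1 th2).
  - rewrite HQ; apply forall_iff; intro w; rewrite <- Eq; symmetry; apply sat_subst_env.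
    extensionality n; destruct n as [|[|n]]; try reflexivity.
    exact (mix_odd n th1 th2).
Qed.

End DefinableRelations.

(** * Arithmetic and induction in M *)

Declare Scope M_scope.
Local Notation "x + y" := (add x y) : M_scope.
Local Notation "x * y" := (mul x y) : M_scope.
Local Notation "x < y" := (lt x y) : M_scope.
Local Notation "x <= y" := (lt x (add y one)) : M_scope.

Section Arithmetic.

Context (M : L1_structure) (A : M -> Prop).
Context (RCA : models_theory (Model M (Delta01_Def M A)) RCA0star).

Local Open Scope M_scope.

Implicit Types x y z n c : M.

Local Notation N := (Model M (Delta01_Def M A)).

(** This makes the assignment of [A] to every set variable admissible when the axioms are
    instantiated. *)
Lemma Delta01_Def_self : Delta01_Def M A A.
Proof.
  exists (Ex (Mem (Var 1) 0)), (All (Mem (Var 1) 0)), (fun _ => zero).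
  split; [do 2 constructor|]; split; [do 2 constructor|].
  split; intro x; simpl; split.
  - intro H; exists zero; exact H.
  - intros [_ H]; exact H.
  - intros H _; exact H.
  - intro H; exact (H zero).
Qed.

Lemma RCA_sat p (rho : nat -> M) : RCA0star p -> sat N rho (fun _ => A) p.
Proof. intro Hp; apply (RCA p Hp rho); intro i; apply Delta01_Def_self. Qed.

Lemma induct (P : M -> Prop) :
  isD M A (fun rho => P (rho O)) ->
  P zero -> (forall x, P x -> P (x + one)) -> forall x, P x.
Proof.
  intros HP H0 HS.
  destruct (isD_sat M A (fun w _ => P w) HP) as [p [rho [Hp E]]].
  assert (E' : forall w : M, sat N (scons w (scons zero rho)) (fun _ => A) p <-> P w)
    by (intro w; rewrite <- (E w zero); apply sat_sets_irrelevant, Hp).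
  pose proof (RCA_sat _ (scons zero rho) (ax_induction p Hp)) as I.
  unfold induction in I; cbn [sat] in I.
  intro x; apply E', I; clear x I; split.
  - apply (sat_subst_env M _ _ _ (scons zero (scons zero rho))); [|apply E', H0].
    extensionality n; destruct n; reflexivity.
  - intros x Hx.
    apply (sat_subst_env M _ _ _ (scons (x + one) (scons zero rho)));
      [|apply E', HS, E', Hx].
    extensionality n; destruct n; reflexivity.
Qed.

Lemma succ_neq_0 (x : M) : x + one <> zero.
Proof. apply (RCA_sat _ (fun _ => x) ax_succ_neq_0). Qed.

Lemma succ_inj (x y : M) : x + one = y + one -> x = y.
Proof. apply (RCA_sat _ (scons x (fun _ => y)) ax_succ_inj). Qed.

Lemma add_0_r (x : M) : x + zero = x.
Proof. apply (RCA_sat _ (fun _ => x) ax_add_0). Qed.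

Lemma add_succ_r (x y : M) : x + (y + one) = x + y + one.
Proof. apply (RCA_sat _ (scons x (fun _ => y)) ax_add_succ). Qed.

Lemma mul_0_r (x : M) : x * zero = zero.
Proof. apply (RCA_sat _ (fun _ => x) ax_mul_0). Qed.

Lemma mul_succ_r (x y : M) : x * (y + one) = x * y + x.
Proof. apply (RCA_sat _ (scons x (fun _ => y)) ax_mul_succ). Qed.

Lemma lt_0 (x : M) : ~ x < zero.
Proof. apply (RCA_sat _ (fun _ => x) ax_lt_0). Qed.

Lemma lt_succ (x y : M) : x < y + one <-> x < y \/ x = y.
Proof. apply (RCA_sat _ (scons x (fun _ => y)) ax_lt_succ). Qed.

(** Proves definability by following the shape of the relation. The last case is for a given term
    function read under quantifiers, where its assignment is shifted. *)
Ltac D_step :=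
  first
  [ assumption | apply T_const | apply T_var | apply T_add | apply T_mul
  | apply D_eq | apply D_lt | apply D_mem | apply D_iff
  | apply D_not | apply D_and | apply D_or
  | apply D_all | apply D_ex | apply D_imp
  | match goal with Hf : isT M _ |- _ => apply (T_rename _ _ _ Hf) end ].

Ltac ind :=
  match goal with |- forall x, @?P x => refine (induct P _ _ _); cbn beta end.
Ltac D := intros; cbn beta; repeat (D_step; cbn beta).

Lemma add_0_l x : zero + x = x.
Proof.
  revert x; ind; [D | apply add_0_r |].
  intros x IH; rewrite add_succ_r, IH; reflexivity.
Qed.

Lemma add_succ_l x y : x + one + y = x + y + one.
Proof.
  revert y; ind; [D | rewrite !add_0_r; reflexivity |].
  intros y IH; rewrite !add_succ_r, IH; reflexivity.
Qed.

Lemma add_comm x y : x + y = y + x.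
Proof.
  revert y; ind; [D | rewrite add_0_l, add_0_r; reflexivity |].
  intros y IH; rewrite add_succ_r, add_succ_l, IH; reflexivity.
Qed.

Lemma add_assoc x y z : x + (y + z) = x + y + z.
Proof.
  revert z; ind; [D | rewrite !add_0_r; reflexivity |].
  intros z IH; rewrite !add_succ_r, IH; reflexivity.
Qed.

Lemma mul_0_l x : zero * x = zero.
Proof.
  revert x; ind; [D | apply mul_0_r |].
  intros x IH; rewrite mul_succ_r, IH; apply add_0_r.
Qed.

Lemma mul_succ_l x y : (x + one) * y = x * y + y.
Proof.
  revert y; ind; [D | rewrite !mul_0_r, add_0_r; reflexivity |].
  intros y IH; rewrite !mul_succ_r, IH, !add_succ_r.
  f_equal; rewrite <- !add_assoc, (add_comm y x); reflexivity.
Qed.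

Lemma mul_comm x y : x * y = y * x.
Proof.
  revert y; ind; [D | rewrite mul_0_l, mul_0_r; reflexivity |].
  intros y IH; rewrite mul_succ_r, mul_succ_l, IH; reflexivity.
Qed.

Lemma mul_add_r x y z : (x + y) * z = x * z + y * z.
Proof.
  revert y; ind; [D | rewrite mul_0_l, !add_0_r; reflexivity |].
  intros y IH; rewrite add_succ_r, !mul_succ_l, IH, add_assoc; reflexivity.
Qed.

Lemma mul_assoc x y z : x * (y * z) = x * y * z.
Proof.
  revert x; ind; [D | rewrite !mul_0_l; reflexivity |].
  intros x IH; rewrite !mul_succ_l, mul_add_r, IH; reflexivity.
Qed.

Lemma mul_1_l x : one * x = x.
Proof. rewrite <- (add_0_l one), mul_succ_l, mul_0_l; apply add_0_l. Qed.

Lemma M_semiring : semi_ring_theory (zero : M) one add mul eq.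
Proof.
  constructor; intros.
  - apply add_0_l.
  - apply add_comm.
  - apply add_assoc.
  - apply mul_1_l.
  - apply mul_0_l.
  - apply mul_comm.
  - apply mul_assoc.
  - apply mul_add_r.
Qed.

Add Ring M_ring : M_semiring.

Lemma add_cancel_r x y z : x + z = y + z -> x = y.
Proof.
  revert z; ind; [D | rewrite !add_0_r; auto |].
  intros z IH E; apply IH, succ_inj; rewrite <- !add_succ_r; exact E.
Qed.

Lemma add_eq_0 x y : x + y = zero -> x = zero /\ y = zero.
Proof.
  assert (Hy : forall y : M, x + y = zero -> y = zero).
  { ind; [D | auto |].
    intros z _ E; rewrite add_succ_r in E; destruct (succ_neq_0 _ E). }
  intro E; pose proof (Hy y E); subst; rewrite add_0_r in E; auto.
Qed.

(** The bound on the predecessor keeps the statement within reach of [induct]. *)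
Lemma zero_or_succ x : x = zero \/ exists y, y <= x /\ x = y + one.
Proof.
  revert x; ind; [D | left; reflexivity |].
  intros x _; right; exists x; rewrite !lt_succ; auto.
Qed.

Lemma succ_lt x y : x < y -> x + one < y + one.
Proof.
  revert y; ind; [D | intro H; destruct (lt_0 _ H) |].
  intros y IH H; apply lt_succ in H; apply lt_succ.
  destruct H as [H| ->]; auto.
Qed.

Lemma lt_iff x y : x < y <-> exists z, y = x + z + one.
Proof.
  split.
  (* The difference is bounded by [y] so that the induction is on a bounded predicate. *)
  - intro H; assert (E : exists z, z < y /\ y = x + z + one);
      [|destruct E as [z [_ E]]; eauto].
    revert y H; ind; [D | intro H; destruct (lt_0 _ H) |].
    intros y IH H; apply lt_succ in H; destruct H as [H | <-].
    + destruct (IH H) as [z [Hz E]]; exists (z + one); split; [|rewrite E; ring].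
      apply succ_lt, Hz.
    + exists zero; split; [|ring].
      clear IH; revert x; ind; [D | apply lt_succ; auto |].
      intros x IH; apply lt_succ; auto.
  - intros [z ->]; revert z; ind; [D | rewrite add_0_r, lt_succ; auto |].
    intros z IH; apply lt_succ; left; rewrite add_assoc; exact IH.
Qed.

Lemma le_iff x y : x <= y <-> exists z, y = x + z.
Proof.
  rewrite lt_iff; split; intros [z E]; exists z.
  - apply (succ_inj _ _ E).
  - rewrite E; reflexivity.
Qed.

Lemma lt_irrefl x : ~ x < x.
Proof.
  rewrite lt_iff; intros [z E].
  apply (succ_neq_0 z), (add_cancel_r _ _ x); rewrite add_0_l.
  rewrite E at 2; ring.
Qed.

Lemma lt_le x y : x < y -> x <= y.
Proof. rewrite lt_succ; auto. Qed.

Lemma le_refl x : x <= x.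
Proof. apply lt_succ; auto. Qed.

Lemma le_0 x : zero <= x.
Proof. apply le_iff; exists x; ring. Qed.

Lemma le_trans x y z : x <= y -> y <= z -> x <= z.
Proof. rewrite !le_iff; intros [a ->] [b ->]; exists (a + b); ring. Qed.

Lemma lt_le_trans x y z : x < y -> y <= z -> x < z.
Proof. rewrite le_iff, !lt_iff; intros [a ->] [b ->]; exists (a + b); ring. Qed.

Lemma le_lt_trans x y z : x <= y -> y < z -> x < z.
Proof. rewrite le_iff, !lt_iff; intros [a ->] [b ->]; exists (a + b); ring. Qed.

Lemma lt_trans x y z : x < y -> y < z -> x < z.
Proof. intros H H'; apply (lt_le_trans _ y); auto using lt_le. Qed.

Lemma le_or_lt x y : x <= y \/ y < x.
Proof.
  revert x; ind; [D | left; apply le_0 |].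
  intros x [H|H].
  - apply le_iff in H; destruct H as [z ->].
    destruct (zero_or_succ z) as [-> | [w [_ ->]]].
    + right; rewrite add_0_r; apply le_refl.
    + left; apply le_iff; exists w; ring.
  - right; apply lt_le; exact H.
Qed.

Lemma not_lt x y : ~ x < y -> y <= x.
Proof. destruct (le_or_lt y x); tauto. Qed.

Lemma lt_not_le x y : x < y -> ~ y <= x.
Proof. intros H H'; apply (lt_irrefl x), (lt_le_trans _ y); assumption. Qed.

Lemma le_antisym x y : x <= y -> y <= x -> x = y.
Proof.
  intros H H'; apply lt_succ in H; destruct H as [H|H]; [|exact H].
  destruct (lt_not_le _ _ H H').
Qed.

Lemma lt_of_succ_le x y : x + one <= y -> x < y.
Proof. rewrite le_iff, lt_iff; intros [z ->]; exists z; ring. Qed.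

Lemma add_le x y x' y' : x <= x' -> y <= y' -> x + y <= x' + y'.
Proof. rewrite !le_iff; intros [a ->] [b ->]; exists (a + b); ring. Qed.

Lemma add_lt_le x y x' y' : x < x' -> y <= y' -> x + y < x' + y'.
Proof. rewrite lt_iff, le_iff, lt_iff; intros [a ->] [b ->]; exists (a + b); ring. Qed.

Lemma mul_le x y x' y' : x <= x' -> y <= y' -> x * y <= x' * y'.
Proof.
  rewrite !le_iff; intros [a ->] [b ->]; exists (x * b + a * y + a * b); ring.
Qed.

Lemma le_add_l x y : x <= x + y.
Proof. apply le_iff; exists y; ring. Qed.

Lemma le_add_r x y : y <= x + y.
Proof. apply le_iff; exists x; ring. Qed.

(** Quantifying over the term function makes definability stable under substitution, so that [P] may
    be applied to any term, also under bounded quantifiers. *)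
Definition isD1 (P : M -> Prop) : Prop :=
  forall f, isT M f -> isD M A (fun rho => P (f rho)).

Definition isD2 (P : M -> M -> Prop) : Prop :=
  forall f g, isT M f -> isT M g -> isD M A (fun rho => P (f rho) (g rho)).

Lemma strong_induct (P : M -> Prop) :
  isD1 P ->
  (forall x, (forall y, y < x -> P y) -> P x) -> forall x, P x.
Proof.
  intros HP HS x; apply HS; revert x; ind.
  - D; apply HP; D.
  - intros y Hy; destruct (lt_0 _ Hy).
  - intros x IH y Hy; apply HS; intros z Hz; apply IH.
    apply (lt_le_trans _ y); [assumption|].
    apply lt_succ in Hy; destruct Hy as [Hy | ->]; [apply lt_le, Hy | apply le_refl].
Qed.

(** Bounded induction on [n]: if [P n] holds, [n] is the greatest element below [n + one], and
    otherwise the one found for [n] still serves. *)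
Lemma greatest (P : M -> Prop) n c :
  isD1 P ->
  c < n -> P c ->
  exists d, d < n /\ c <= d /\ P d /\ (forall e, e < n -> d < e -> ~ P e).
Proof.
  intros HP Hc Pc; revert n Hc; ind.
  - D; apply HP; D.
  - intro Hc; destruct (lt_0 _ Hc).
  - intros n IH Hc; destruct (classic (P n)) as [Pn|Pn].
    + exists n; repeat split; [apply le_refl | exact Hc | exact Pn |].
      intros e He He'; destruct (lt_not_le _ _ He' He).
    + apply lt_succ in Hc; destruct Hc as [Hc| <-]; [|tauto].
      destruct (IH Hc) as [d [Hd [Hcd [Pd Hmax]]]].
      exists d; repeat split; auto using lt_le.
      intros e He He'; apply lt_succ in He; destruct He as [He| ->]; auto.
Qed.

(** * Codes of finite sets *)

(** The value of the term [pair] in [COH]. It is injective because [x] is smaller than the gap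
    between the squares of [x + y] and its successor. *)
Definition cpair x y : M := (x + y) * (x + y) + x.

Lemma cpair_lt x y x' y' : x + y < x' + y' -> cpair x y < cpair x' y'.
Proof.
  unfold cpair; rewrite !lt_iff; intros [z ->].
  (* With s = x + y, this is (s + z + 1)^2 + x' minus s^2 + x + 1, where s - x is written as [y]. *)
  exists (y + (x + y) + (x + y) * z + (x + y) * z + z * z + z + z + x'); ring.
Qed.

Lemma cpair_inj x y x' y' : cpair x y = cpair x' y' -> x = x' /\ y = y'.
Proof.
  intro E.
  assert (S : x + y = x' + y').
  { apply le_antisym; apply not_lt; intro H; apply cpair_lt in H;
      rewrite E in H; exact (lt_irrefl _ H). }
  unfold cpair in E; rewrite S, !(add_comm (_ * _)) in E.
  apply add_cancel_r in E; subst x'; split; [reflexivity|].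
  rewrite !(add_comm x) in S; exact (add_cancel_r _ _ _ S).
Qed.

Lemma le_cpair_l x y : x <= cpair x y.
Proof. apply le_add_r. Qed.

Lemma le_cpair_r x y : y <= cpair x y.
Proof.
  unfold cpair; destruct (zero_or_succ (x + y)) as [E | [k [_ E]]].
  - apply add_eq_0 in E; destruct E as [-> ->]; apply le_0.
  - rewrite E at 1; apply le_iff; exists (x + k * (x + y) + x).
    ring.
Qed.

Lemma cpair_le x y x' y' : x <= x' -> y <= y' -> cpair x y <= cpair x' y'.
Proof. intros H H'; repeat (apply add_le || apply mul_le); assumption. Qed.

Lemma cpair_00 : cpair zero zero = zero.
Proof. unfold cpair; ring. Qed.

(** The relation expressed by [beta], with the quotient bounded by [a] to make it bounded-definable.
    The bound is harmless as the modulus is at least 1. *)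
Definition bet a b i (r : M) : Prop :=
  r < one + (i + one) * b /\ exists q, q <= a /\ a = q * (one + (i + one) * b) + r.

Lemma bet_le a b i r : bet a b i r -> r <= a.
Proof. intros [_ [q [_ E]]]; rewrite E; apply le_add_r. Qed.

Lemma bet_unique a b i r r' : bet a b i r -> bet a b i r' -> r = r'.
Proof.
  unfold bet; generalize (one + (i + one) * b); intro m.
  assert (H : forall q q' s s', s < m -> q * m + s = q' * m + s' -> q' <= q).
  { intros q q' s s' Hs E; apply not_lt; rewrite lt_iff; intros [z ->].
    apply (lt_not_le _ _ Hs), le_iff; exists (z * m + s').
    apply (add_cancel_r _ _ (q * m)); rewrite (add_comm s), E; ring. }
  intros [Hr [q [_ E]]] [Hr' [q' [_ E']]].
  rewrite E in E'; assert (q = q') as <- by (apply le_antisym; eauto).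
  rewrite !(add_comm (_ * _)) in E'; exact (add_cancel_r _ _ _ E').
Qed.

(** A beta-code of the sequence 1, 2, 4, up to 2^n. Powers of 2 are always looked up in such a
    table. *)
Definition table a b n : Prop :=
  bet a b zero one /\
  forall i, i < n -> exists r, bet a b i r /\ bet a b (i + one) (r + r).

Lemma bet_intro a b i r q :
  r < one + (i + one) * b -> a = q * (one + (i + one) * b) + r -> bet a b i r.
Proof.
  intros Hr E; split; [exact Hr|]; exists q; split; [|exact E].
  rewrite E; apply le_iff; exists (q * (i + one) * b + r); ring.
Qed.

(** The truth of [power2] is witnessed by exactly such a beta-code. *)
Lemma table_exists n : exists a b, table a b n.
Proof.
  destruct (RCA_sat _ (fun _ => zero) ax_exp n) as [y [a [b [H0 [HS _]]]]].
  exists a, b; simpl in H0, HS.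
  assert (B : forall i r, r < one + (i + one) * b /\
    (exists q, a = q * (one + (i + one) * b) + r) -> bet a b i r)
    by (intros i r [Hr [q E]]; exact (bet_intro _ _ _ _ _ Hr E)).
  split; [apply B, H0|].
  intros i Hi; destruct (HS i Hi) as [r [H1 H2]]; exists r; split; apply B; assumption.
Qed.

(** With p = 2^j from the table, digit [j] of [s] is 1 when the quotient of [s] by p is odd. *)
Definition bit (s a b j : M) : Prop :=
  exists p, p <= a /\ bet a b j p /\
  exists q, q <= s /\ exists r, r < p /\ s = (q + q + one) * p + r.

Lemma bit_iff s a b j :
  bit s a b j <-> exists p, bet a b j p /\ exists q r, r < p /\ s = (q + q + one) * p + r.
Proof.
  split.
  - intros [p [_ [Hp [q [_ [r [Hr E]]]]]]]; eauto 6.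
  - intros [p [Hp [q [r [Hr E]]]]].
    exists p; split; [apply (bet_le _ _ _ _ Hp)|]; split; [exact Hp|].
    exists q; split; [|exists r; auto].
    assert (P : zero < p) by (apply (le_lt_trans _ r); [apply le_0 | exact Hr]).
    apply lt_iff in P; destruct P as [z ->]; rewrite E; apply le_iff.
    exists (q + one + (q + q + one) * z + r); ring.
Qed.

(** A code carries its own table of powers next to the length [l] and the digits [s], so that
    membership is bounded in the code alone. *)
Definition code l s a b : M := cpair l (cpair s (cpair a b)).

Definition mem t j : Prop :=
  exists l, l <= t /\ exists s, s <= t /\ exists a, a <= t /\ exists b, b <= t /\
    t = code l s a b /\ j < l /\ bit s a b j.

Lemma mem_code l s a b j : mem (code l s a b) j <-> j < l /\ bit s a b j.
Proof.
  split.
  - intros [l' [_ [s' [_ [a' [_ [b' [_ [E H]]]]]]]]].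
    apply cpair_inj in E; destruct E as [-> E].
    apply cpair_inj in E; destruct E as [-> E].
    apply cpair_inj in E; destruct E as [-> ->]; exact H.
  - intro H; exists l; split; [apply le_cpair_l|].
    exists s; split; [eapply le_trans; [apply le_cpair_l | apply le_cpair_r]|].
    exists a; split;
      [eapply le_trans; [apply le_cpair_l|]; eapply le_trans; apply le_cpair_r|].
    exists b; split;
      [eapply le_trans; [apply le_cpair_r|]; eapply le_trans; apply le_cpair_r|].
    auto.
Qed.

Lemma mem_lt t j : mem t j -> j < t.
Proof.
  intros [l [H [s [_ [a [_ [b [_ [_ [Hj _]]]]]]]]]].
  exact (lt_le_trans _ _ _ Hj H).
Qed.

Section Table.

Context (a b n : M) (T : table a b n).

Lemma table_value i : i <= n -> exists p, p <= a /\ zero < p /\ bet a b i p.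
Proof.
  revert i; ind; [D | |].
  - intros _; exists one; destruct T as [T0 _]; split; [apply (bet_le _ _ _ _ T0)|].
    split; [|exact T0]; apply lt_iff; exists zero; ring.
  - intros i IH Hi; destruct IH as [p [Hpa [Hp Bp]]]; [apply lt_le, lt_of_succ_le, Hi|].
    destruct T as [_ TS]; destruct (TS i) as [r [Br Br']].
    { apply lt_of_succ_le, Hi. }
    rewrite (bet_unique _ _ _ _ _ Br Bp) in Br'; exists (p + p).
    split; [apply (bet_le _ _ _ _ Br')|]; split; [|exact Br'].
    apply (lt_le_trans _ p); [exact Hp | apply le_add_l].
Qed.

Lemma table_step i p : i < n -> bet a b i p -> bet a b (i + one) (p + p).
Proof.
  intros Hi Bp; destruct T as [_ TS]; destruct (TS i Hi) as [r [Br Br']].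
  rewrite (bet_unique _ _ _ _ _ Br Bp) in Br'; exact Br'.
Qed.

(** Doubling the power of 2 doubles the cofactor [m]. The bounds by [a] and by [p] keep the
    induction bounded. *)
Lemma table_divides i : i <= n -> forall p, p <= a -> bet a b i p ->
  forall j, j < i -> forall q, q <= a -> bet a b j q ->
  exists m, m <= p /\ p = (q + q) * m.
Proof.
  revert i; ind; [D | intros _ p _ _ j Hj; destruct (lt_0 _ Hj) |].
  intros i IH Hi p' _ Bp' j Hj q Hq Bq.
  assert (Hin : i < n) by (apply lt_of_succ_le, Hi).
  destruct (table_value i (lt_le _ _ Hin)) as [p [Hpa [Hp Bp]]].
  rewrite (bet_unique _ _ _ _ _ Bp' (table_step _ _ Hin Bp)).
  apply lt_succ in Hj; destruct Hj as [Hj | ->].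
  - destruct (IH (lt_le _ _ Hin) p Hpa Bp j Hj q Hq Bq) as [m [Hm E]].
    exists (m + m); split; [apply add_le; exact Hm | rewrite E; ring].
  - rewrite (bet_unique _ _ _ _ _ Bp Bq) in *; exists one.
    split; [|ring]; apply lt_iff in Hp; destruct Hp as [z ->].
    apply le_iff; exists (z + z + one); ring.
Qed.

(** For j < i, adding 2^i adds a multiple of 2^(j + 1), which keeps the remainder modulo 2^j and the
    parity of the quotient. *)
Lemma bit_add_above i p s j : i <= n -> bet a b i p -> j < i ->
  bit (s + p) a b j <-> bit s a b j.
Proof.
  intros Hi Bp Hj; rewrite !bit_iff; apply exists_iff; intro q.
  assert (E : bet a b j q -> exists m, p = (q + q) * m).
  { intro Bq; destruct (table_divides i Hi p (bet_le _ _ _ _ Bp) Bp j Hj q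
      (bet_le _ _ _ _ Bq) Bq) as [m [_ Em]]; eauto. }
  split; intros [Bq [k [r [Hr Es]]]]; split; try exact Bq;
    destruct (E Bq) as [m Em]; subst p.
  - destruct (le_or_lt m k) as [H|H].
    + apply le_iff in H; destruct H as [d ->]; exists d, r; split; [exact Hr|].
      apply (add_cancel_r _ _ ((q + q) * m)); rewrite Es; ring.
    (* If the quotient were too small for the subtraction, then r = q + s + 2 q d, contradicting r <
       q. *)
    + apply lt_iff in H; destruct H as [d ->]; exfalso.
      apply (lt_not_le _ _ Hr), le_iff; exists (s + (q + q) * d).
      apply (add_cancel_r _ _ ((k + k + one) * q)).
      rewrite (add_comm r), <- Es; ring.
  - exists (k + m), r; split; [exact Hr | rewrite Es; ring].
Qed.

Lemma bit_add_self i p s : bet a b i p -> s < p -> bit (s + p) a b i.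
Proof.
  intros Bp Hs; apply bit_iff; exists p; split; [exact Bp|].
  exists zero, s; split; [exact Hs | ring].
Qed.

Lemma bit_small i p s : bet a b i p -> s < p -> ~ bit s a b i.
Proof.
  intros Bp Hs H; apply bit_iff in H; destruct H as [q [Bq [k [r [_ E]]]]].
  rewrite (bet_unique _ _ _ _ _ Bq Bp) in E.
  apply (lt_not_le _ _ Hs), le_iff; exists ((k + k) * p + r); rewrite E; ring.
Qed.

End Table.

(** Builds the set one bit at a time; the induction is bounded because the
    partial codes stay below the powers of 2 listed in a fixed table. *)
Lemma bounded_recursion (Q : M -> M -> Prop) :
  isD2 Q ->
  (forall j t t', (forall k, k < j -> mem t k <-> mem t' k) -> Q j t -> Q j t') ->
  forall n, exists t, forall j, mem t j <-> j < n /\ Q j t.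
Proof.
  intros DQ local n; destruct (table_exists n) as [a [b T]].
  assert (C : forall i, i <= n -> exists p, p <= a /\ bet a b i p /\
    exists s, s < p /\
    forall j, j < i -> bit s a b j <-> Q j (code n s a b)).
  { ind; [D; apply DQ; D | |].
    - intros _; exists one; destruct T as [T0 _]; split; [apply (bet_le _ _ _ _ T0)|].
      split; [exact T0|]; exists zero; split; [apply lt_iff; exists zero; ring|].
      intros j Hj; destruct (lt_0 _ Hj).
    - intros i IH Hi.
      assert (Hin : i < n) by (apply lt_of_succ_le, Hi).
      destruct (IH (lt_le _ _ Hin)) as [p [Hpa [Bp [s [Hs Hbits]]]]]; clear IH.
      pose proof (table_step _ _ _ T _ _ Hin Bp) as Bp'.
      exists (p + p); split; [apply (bet_le _ _ _ _ Bp')|]; split; [exact Bp'|].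
      assert (same : forall j, j < i ->
        mem (code n s a b) j <-> mem (code n (s + p) a b) j).
      { intros j Hj; rewrite !mem_code.
        rewrite (bit_add_above _ _ _ T i p s j (lt_le _ _ Hin) Bp Hj); tauto. }
      (* Setting digit [i] changes no digit below any j <= i, so by locality the decisions up to [i]
         stand. *)
      assert (sameQ : forall j, j <= i ->
        Q j (code n s a b) <-> Q j (code n (s + p) a b)).
      { intros j Hj; split; apply local; intros k Hk;
          rewrite (same k (lt_le_trans _ _ _ Hk Hj)); tauto. }
      destruct (classic (Q i (code n s a b))) as [Hq|Hq].
      + exists (s + p); split; [apply add_lt_le; [exact Hs | apply le_refl]|].
        intros j Hj; rewrite <- (sameQ j Hj).
        apply lt_succ in Hj; destruct Hj as [Hj| ->].
        * rewrite <- (Hbits j Hj).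
          apply (bit_add_above _ _ _ T i p s j (lt_le _ _ Hin) Bp Hj).
        * split; intro; [exact Hq | apply bit_add_self; assumption].
      + exists s; split; [apply (lt_le_trans _ p); [exact Hs | apply le_add_l]|].
        intros j Hj; apply lt_succ in Hj; destruct Hj as [Hj| ->]; [auto|].
        split; intro H; [destruct (bit_small _ _ _ _ _ Bp Hs H) | tauto]. }
  destruct (C n (le_refl n)) as [p [_ [_ [s [_ Hbits]]]]].
  exists (code n s a b); intro j; rewrite mem_code.
  split; intros [Hj H]; split; try apply Hbits; assumption.
Qed.

Lemma bounded_comprehension (P : M -> Prop) :
  isD1 P -> forall n, exists t, forall j, mem t j <-> j < n /\ P j.
Proof.
  intro DP; apply (bounded_recursion (fun j _ => P j)); [|auto].
  intros f g Hf _; apply DP, Hf.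
Qed.

(** * Programs and certificates *)

Fixpoint num (k : nat) : M :=
  match k with O => zero | S k => num k + one end.

Lemma num_inj k l : num k = num l -> k = l.
Proof.
  revert l; induction k; destruct l; simpl; intro E; auto.
  - symmetry in E; destruct (succ_neq_0 _ E).
  - destruct (succ_neq_0 _ E).
  - f_equal; apply IHk, succ_inj, E.
Qed.

(** Variables are looked up by pushing a copy of the whole stack as one value ([Copy]), removing
    entries from that copy ([Drop]) and replacing it by its first entry ([Fetch]). *)
Inductive op : Type := Copy | Drop | Fetch | PushZero | PushOne | OpAdd | OpMul.

Definition op_dom (o : op) (a b u : M) : M :=
  match o with
  | Copy | PushZero | PushOne => u
  | Drop | Fetch => cpair (cpair a b) u
  | OpAdd | OpMul => cpair a (cpair b u)
  end.

Definition op_val (o : op) (a b u : M) : M :=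
  match o with
  | Copy => cpair u u
  | Drop => cpair b u
  | Fetch => cpair a u
  | PushZero => cpair zero u
  | PushOne => cpair one u
  | OpAdd => cpair (b + a) u
  | OpMul => cpair (b * a) u
  end.

Definition op_index (o : op) : nat :=
  match o with
  | Copy => 0 | Drop => 1 | Fetch => 2 | PushZero => 3 | PushOne => 4
  | OpAdd => 5 | OpMul => 6
  end.

(** Spelled out as a finite disjunction, since a quantifier over [op] is not a bounded quantifier of
    [M]. *)
Definition some_op (P : op -> Prop) : Prop :=
  P Copy \/ P Drop \/ P Fetch \/ P PushZero \/ P PushOne \/ P OpAdd \/ P OpMul.

Lemma some_op_iff P : some_op P <-> exists o, P o.
Proof.
  unfold some_op; split; [intuition eauto|].
  intros [[] H]; tauto.
Qed.

Definition rule_lt (v : M) : Prop :=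
  exists a, a <= v /\ exists b, b <= v /\ exists u, u <= v /\
    v = cpair a (cpair b u) /\ a < b.

Definition rule_in (v : M) : Prop :=
  exists a, a <= v /\ exists u, u <= v /\ v = cpair a u /\ A a.

Definition rule_not_in (v : M) : Prop :=
  exists a, a <= v /\ exists u, u <= v /\ v = cpair a u /\ ~ A a.

(** In this and the next two rules [H] stands for the truth of a subprogram in [holds], and for the
    presence of the corresponding fact in [justified]. *)
Definition rule_all (v : M) (H : M -> Prop) : Prop :=
  exists b, b <= v /\ exists u, u <= v /\ v = cpair b u /\
    forall x, x < b -> H (cpair x u).

Definition rule_ex (v : M) (H : M -> Prop) : Prop :=
  exists b, b <= v /\ exists u, u <= v /\ v = cpair b u /\
    exists x, x < b /\ H (cpair x u).

Definition rule_op (o : op) (v : M) (H : M -> Prop) : Prop :=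
  exists a, a <= v /\ exists b, b <= v /\ exists u, u <= v /\
    v = op_dom o a b u /\ H (op_val o a b u).

(** Programs run on a stack, coded as a nested pair; a program is a formula in
    negation normal form whose terms have been compiled to stack operations. *)
Inductive prog : Type :=
| PLt | PIn | PNotIn
| PAnd (p q : prog) | POr (p q : prog)
| PAll (p : prog) | PEx (p : prog)
| POp (o : op) (p : prog).

(** The recursion is external: it gives a bounded definition for each program separately.
    Certificates provide one definition for all codes. *)
Fixpoint holds (p : prog) (v : M) : Prop :=
  match p with
  | PLt => rule_lt v
  | PIn => rule_in v
  | PNotIn => rule_not_in v
  | PAnd p q => holds p v /\ holds q v
  | POr p q => holds p v \/ holds q v
  | PAll p => rule_all v (holds p)
  | PEx p => rule_ex v (holds p)
  | POp o p => rule_op o v (holds p)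
  end.

Fixpoint pcode (p : prog) : M :=
  match p with
  | PLt => cpair (num 0) zero
  | PIn => cpair (num 1) zero
  | PNotIn => cpair (num 2) zero
  | PAnd p q => cpair (num 3) (cpair (pcode p) (pcode q))
  | POr p q => cpair (num 4) (cpair (pcode p) (pcode q))
  | PAll p => cpair (num 5) (pcode p)
  | PEx p => cpair (num 6) (pcode p)
  | POp o p => cpair (num 7) (cpair (num (op_index o)) (pcode p))
  end.

(** The fact x, read as "program c holds at stack v" for x = <c, v>, follows in
    one step from the facts in H. *)
Definition justified (H : M -> Prop) (x : M) : Prop :=
  exists c, c <= x /\ exists v, v <= x /\ x = cpair c v /\
  exists k, k <= c /\ exists e, e <= c /\ c = cpair k e /\
  ((k = num 0 /\ rule_lt v) \/
   (k = num 1 /\ rule_in v) \/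
   (k = num 2 /\ rule_not_in v) \/
   (k = num 3 /\ exists p, p <= e /\ exists q, q <= e /\ e = cpair p q /\
      H (cpair p v) /\ H (cpair q v)) \/
   (k = num 4 /\ exists p, p <= e /\ exists q, q <= e /\ e = cpair p q /\
      (H (cpair p v) \/ H (cpair q v))) \/
   (k = num 5 /\ rule_all v (fun w => H (cpair e w))) \/
   (k = num 6 /\ rule_ex v (fun w => H (cpair e w))) \/
   (k = num 7 /\ exists i, i <= e /\ exists p, p <= e /\ e = cpair i p /\
      some_op (fun o => i = num (op_index o) /\
        rule_op o v (fun w => H (cpair p w))))).

Definition justified_prog (H : M -> Prop) (p : prog) (v : M) : Prop :=
  match p with
  | PLt => rule_lt v
  | PIn => rule_in v
  | PNotIn => rule_not_in v
  | PAnd p q => H (cpair (pcode p) v) /\ H (cpair (pcode q) v)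
  | POr p q => H (cpair (pcode p) v) \/ H (cpair (pcode q) v)
  | PAll p => rule_all v (fun w => H (cpair (pcode p) w))
  | PEx p => rule_ex v (fun w => H (cpair (pcode p) w))
  | POp o p => rule_op o v (fun w => H (cpair (pcode p) w))
  end.

Lemma justified_iff H p v :
  justified H (cpair (pcode p) v) <-> justified_prog H p v.
Proof.
  split.
  - intros [c [_ [v' [_ [E [k [_ [e [_ [Ec J]]]]]]]]]].
    apply cpair_inj in E; destruct E as [E <-]; rewrite Ec in E; clear Ec c.
    destruct p; cbn [pcode justified_prog] in E |- *;
      apply cpair_inj in E; destruct E as [<- <-];
      repeat (destruct J as [J|J];
        [destruct J as [K J]; apply num_inj in K; try discriminate K|]);
      try (destruct J as [K J]; apply num_inj in K; try discriminate K);
      try exact J.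
    + destruct J as [p [_ [q [_ [E J]]]]]; apply cpair_inj in E.
      destruct E as [-> ->]; exact J.
    + destruct J as [p [_ [q [_ [E J]]]]]; apply cpair_inj in E.
      destruct E as [-> ->]; exact J.
    + destruct J as [i [_ [q [_ [E J]]]]]; apply cpair_inj in E.
      destruct E as [<- <-]; apply some_op_iff in J; destruct J as [o' [E J]].
      apply num_inj in E; replace o with o'; [exact J|].
      destruct o, o'; (reflexivity || discriminate E).
  - intro J; exists (pcode p); split; [apply le_cpair_l|].
    exists v; split; [apply le_cpair_r|]; split; [reflexivity|].
    destruct p; cbn [pcode justified_prog] in *;
      match goal with |- context [cpair (num ?k) ?e = _] =>
        exists (num k); split; [apply le_cpair_l|];
        exists e; split; [apply le_cpair_r|]; split; [reflexivity|]
      end.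
    + tauto.
    + tauto.
    + tauto.
    + do 3 right; left; split; [reflexivity|].
      eexists; split; [apply le_cpair_l|]; eexists; split; [apply le_cpair_r|]; auto.
    + do 4 right; left; split; [reflexivity|].
      eexists; split; [apply le_cpair_l|]; eexists; split; [apply le_cpair_r|]; auto.
    + do 5 right; left; auto.
    + do 6 right; left; auto.
    + do 7 right; split; [reflexivity|].
      eexists; split; [apply le_cpair_l|]; eexists; split; [apply le_cpair_r|].
      split; [reflexivity|]; apply some_op_iff; eauto.
Qed.

Lemma rule_all_mono v (H H' : M -> Prop) :
  (forall w, H w -> H' w) -> rule_all v H -> rule_all v H'.
Proof. unfold rule_all; firstorder. Qed.

Lemma rule_ex_mono v (H H' : M -> Prop) :
  (forall w, H w -> H' w) -> rule_ex v H -> rule_ex v H'.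
Proof.
  intros HH [b [Hb [u [Hu [E [x [Hx J]]]]]]].
  exists b; split; [exact Hb|]; exists u; split; [exact Hu|]; split; [exact E|].
  exists x; auto.
Qed.

Lemma rule_op_mono o v (H H' : M -> Prop) :
  (forall w, H w -> H' w) -> rule_op o v H -> rule_op o v H'.
Proof.
  intros HH [a [Ha [b [Hb [u [Hu [E J]]]]]]].
  exists a; split; [exact Ha|]; exists b; split; [exact Hb|].
  exists u; split; [exact Hu|]; auto.
Qed.

(** Premises occur only positively in the rules, which is what the negation normal form is for.
    Certificates can therefore be enlarged. *)
Lemma justified_mono (H H' : M -> Prop) x :
  (forall w, H w -> H' w) -> justified H x -> justified H' x.
Proof.
  intros HH [c [Hc [v [Hv [E [k [Hk [e [He [Ec J]]]]]]]]]].
  exists c; split; [exact Hc|]; exists v; split; [exact Hv|]; split; [exact E|].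
  exists k; split; [exact Hk|]; exists e; split; [exact He|]; split; [exact Ec|].
  destruct J as [J|[J|[J|[[K J]|[[K J]|[[K J]|[[K J]|[K J]]]]]]]].
  - left; exact J.
  - right; left; exact J.
  - do 2 right; left; exact J.
  - do 3 right; left; split; [exact K|].
    destruct J as [p [Hp [q [Hq [E' J]]]]].
    exists p; split; [exact Hp|]; exists q; split; [exact Hq|]; intuition auto.
  - do 4 right; left; split; [exact K|].
    destruct J as [p [Hp [q [Hq [E' J]]]]].
    exists p; split; [exact Hp|]; exists q; split; [exact Hq|]; intuition auto.
  - do 5 right; left; split; [exact K|]; revert J; apply rule_all_mono; auto.
  - do 6 right; left; split; [exact K|]; revert J; apply rule_ex_mono; auto.
  - do 7 right; split; [exact K|].
    destruct J as [i [Hi [p [Hp [E' J]]]]].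
    exists i; split; [exact Hi|]; exists p; split; [exact Hp|]; split; [exact E'|].
    apply some_op_iff in J; apply some_op_iff; destruct J as [o [Eo J]].
    exists o; split; [exact Eo|]; revert J; apply rule_op_mono; auto.
Qed.

(** * Soundness and existence of certificates *)

Definition certificate t : Prop := forall x, x < t -> mem t x -> justified (mem t) x.

(** Justification passes to immediate subprograms, so external induction on [p] suffices; facts in
    [t] about numbers that code no program do no harm. *)
Lemma certificate_sound t : certificate t ->
  forall p v, mem t (cpair (pcode p) v) -> holds p v.
Proof.
  intros C; assert (J : forall p v, mem t (cpair (pcode p) v) ->
    justified_prog (mem t) p v)
    by (intros p v H; apply justified_iff, C; [apply mem_lt|]; exact H).
  induction p; intros v H; apply J in H; cbn [holds justified_prog] in *; auto.
  - destruct H; auto.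
  - destruct H; auto.
  - revert H; apply rule_all_mono; auto.
  - revert H; apply rule_ex_mono; auto.
  - revert H; apply rule_op_mono; auto.
Qed.

Lemma D_holds p : isD1 (holds p).
Proof.
  unfold isD1; induction p; intros f Hf; cbn [holds].
  - D.
  - D.
  - D.
  - D_step; auto.
  - D_step; auto.
  - unfold rule_all; D; apply IHp; D.
  - unfold rule_ex; D; apply IHp; D.
  - destruct o; unfold rule_op; D; apply IHp; D.
Qed.

Lemma certificate_extend t1 t2 (P : M -> Prop) n :
  isD1 P -> certificate t1 -> certificate t2 ->
  (forall x, P x -> justified (fun y => mem t1 y \/ mem t2 y) x) ->
  exists t, certificate t /\ (forall x, mem t1 x -> mem t x) /\
    (forall x, mem t2 x -> mem t x) /\ (forall x, x < n -> P x -> mem t x).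
Proof.
  intros DP C1 C2 HP.
  (* Members of a code lie below it, so this bound cuts nothing off [t1] or [t2], and no element of
     [P] below [n]. *)
  destruct (bounded_comprehension (fun x => mem t1 x \/ mem t2 x \/ P x))
    with (n := t1 + t2 + n) as [t Ht].
  { intros f Hf; D; apply DP; D. }
  assert (S1 : forall x, mem t1 x -> mem t x).
  { intros x Hx; apply Ht; split; [|auto].
    apply (lt_le_trans _ _ _ (mem_lt _ _ Hx)), le_iff; exists (t2 + n); ring. }
  assert (S2 : forall x, mem t2 x -> mem t x).
  { intros x Hx; apply Ht; split; [|auto].
    apply (lt_le_trans _ _ _ (mem_lt _ _ Hx)), le_iff; exists (t1 + n); ring. }
  exists t; split; [|split; [exact S1|split; [exact S2|]]].
  - intros x _ Hx; apply Ht in Hx; destruct Hx as [_ [Hx|[Hx|Hx]]].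
    + apply (justified_mono (mem t1)); [exact S1|].
      apply C1; [apply mem_lt|]; exact Hx.
    + apply (justified_mono (mem t2)); [exact S2|].
      apply C2; [apply mem_lt|]; exact Hx.
    + apply (justified_mono (fun y => mem t1 y \/ mem t2 y)); [|auto].
      intros w [Hw|Hw]; auto.
  - intros x Hx Px; apply Ht; split; [|auto].
    apply (lt_le_trans _ _ _ Hx), le_iff; exists (t1 + t2); ring.
Qed.

Lemma certificate_step p B t1 t2 :
  certificate t1 -> certificate t2 ->
  (forall v, v < B -> holds p v ->
    justified_prog (fun y => mem t1 y \/ mem t2 y) p v) ->
  exists t, certificate t /\
    forall v, v < B -> holds p v -> mem t (cpair (pcode p) v).
Proof.
  intros C1 C2 J.
  destruct (certificate_extend t1 t2
    (fun x => exists v, v < B /\ x = cpair (pcode p) v /\ holds p v)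
    (cpair (pcode p) B + one)) as [t [C [_ [_ Ht]]]]; try assumption.
  - intros f Hf; D; apply (D_holds p); D.
  - intros x [v [Hv [-> Hp]]]; apply justified_iff; auto.
  - exists t; split; [exact C|]; intros v Hv Hp; apply Ht; [|eauto].
    apply cpair_le; [apply le_refl | apply lt_le, Hv].
Qed.

Lemma certificate_0 : certificate zero.
Proof. intros x Hx; destruct (lt_0 _ Hx). Qed.

Lemma op_bound o B : exists B', forall a b u,
  a <= B -> b <= B -> u <= B -> op_val o a b u < B'.
Proof.
  (* The first component dominates every value that an operation can push: 0, 1, an old entry, a sum
     or a product. *)
  exists (cpair (B * B + B + B + one) B + one); intros a b u Ha Hb Hu.
  assert (HB : B <= B * B + B + B + one)
    by (apply le_iff; exists (B * B + B + one); ring).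
  destruct o; apply cpair_le; auto; try (eapply le_trans; eassumption).
  - apply le_0.
  - apply le_add_r.
  - apply (le_trans _ (B + B)); [apply add_le; assumption|].
    apply le_iff; exists (B * B + one); ring.
  - apply (le_trans _ (B * B)); [apply mul_le; assumption|].
    apply le_iff; exists (B + B + one); ring.
Qed.

(** No collection is needed: every stack reached from one below B lies below a
    bound depending only on the program and B. *)
Lemma certificate_exists p B :
  exists t, certificate t /\ forall v, v < B -> holds p v -> mem t (cpair (pcode p) v).
Proof.
  revert B; induction p; intro B.
  - apply (certificate_step _ _ zero zero certificate_0 certificate_0); auto.
  - apply (certificate_step _ _ zero zero certificate_0 certificate_0); auto.
  - apply (certificate_step _ _ zero zero certificate_0 certificate_0); auto.
  - destruct (IHp1 B) as [t1 [C1 H1]], (IHp2 B) as [t2 [C2 H2]].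
    apply (certificate_step _ _ t1 t2 C1 C2).
    intros v Hv [Hp Hq]; split; auto.
  - destruct (IHp1 B) as [t1 [C1 H1]], (IHp2 B) as [t2 [C2 H2]].
    apply (certificate_step _ _ t1 t2 C1 C2).
    intros v Hv [Hp|Hq]; [left|right]; auto.
  - destruct (IHp B) as [t [C Ht]]; apply (certificate_step _ _ t t C C).
    intros v Hv [b [Hb [u [Hu [E H]]]]].
    exists b; split; [exact Hb|]; exists u; split; [exact Hu|]; split; [exact E|].
    intros x Hx; left; apply Ht; [|auto].
    apply (le_lt_trans _ v); [|exact Hv].
    rewrite E; apply cpair_le; [apply lt_le, Hx | apply le_refl].
  - destruct (IHp B) as [t [C Ht]]; apply (certificate_step _ _ t t C C).
    intros v Hv [b [Hb [u [Hu [E [x [Hx H]]]]]]].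
    exists b; split; [exact Hb|]; exists u; split; [exact Hu|]; split; [exact E|].
    exists x; split; [exact Hx|]; left; apply Ht; [|auto].
    apply (le_lt_trans _ v); [|exact Hv].
    rewrite E; apply cpair_le; [apply lt_le, Hx | apply le_refl].
  - destruct (op_bound o B) as [B' HB'], (IHp B') as [t [C Ht]].
    apply (certificate_step _ _ t t C C).
    intros v Hv [a [Ha [b [Hb [u [Hu [E H]]]]]]].
    assert (L : forall x, x <= v -> x <= B)
      by (intros x Hx; apply (le_trans _ v); [exact Hx | apply lt_le, Hv]).
    exists a; split; [exact Ha|]; exists b; split; [exact Hb|].
    exists u; split; [exact Hu|]; split; [exact E|]; left; auto.
Qed.

(** * Compilation of bounded formulas *)

Definition enc : list M -> M := fold_right cpair zero.

Definition env (l : list M) (n : nat) : M := nth n l zero.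

Lemma env_cons a l : env (a :: l) = scons a (env l).
Proof. extensionality n; destruct n; reflexivity. Qed.

(** By injectivity of pairing, [v] determines those of [a], [b], [u] that occur in the result of the
    operation. *)
Lemma holds_op o p a b u v : v = op_dom o a b u ->
  a <= v -> b <= v -> u <= v -> holds (POp o p) v <-> holds p (op_val o a b u).
Proof.
  intros E Ha Hb Hu; cbn [holds]; split.
  - intros [a' [_ [b' [_ [u' [_ [E' H]]]]]]]; rewrite E in E'.
    replace (op_val o a b u) with (op_val o a' b' u'); [exact H|].
    destruct o; cbn [op_dom op_val] in *;
      repeat match goal with
      | E : cpair _ _ = cpair _ _ |- _ => apply cpair_inj in E; destruct E
      end; congruence.
  - intro H; exists a; split; [exact Ha|]; exists b; split; [exact Hb|].
    exists u; split; [exact Hu|]; split; assumption.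
Qed.

Lemma holds_copy p v : holds (POp Copy p) v <-> holds p (cpair v v).
Proof.
  apply (holds_op Copy p zero zero v v); (reflexivity || apply le_0 || apply le_refl).
Qed.

Lemma holds_zero p v : holds (POp PushZero p) v <-> holds p (cpair zero v).
Proof.
  apply (holds_op PushZero p zero zero v v); (reflexivity || apply le_0 || apply le_refl).
Qed.

Lemma holds_one p v : holds (POp PushOne p) v <-> holds p (cpair one v).
Proof.
  apply (holds_op PushOne p zero zero v v); (reflexivity || apply le_0 || apply le_refl).
Qed.

Lemma le_cpair_2 a b u : b <= cpair a (cpair b u).
Proof. apply (le_trans _ (cpair b u)); [apply le_cpair_l | apply le_cpair_r]. Qed.

Lemma le_cpair_3 a b u : u <= cpair a (cpair b u).
Proof. apply (le_trans _ (cpair b u)); apply le_cpair_r. Qed.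

Lemma holds_add p a b u :
  holds (POp OpAdd p) (cpair a (cpair b u)) <-> holds p (cpair (b + a) u).
Proof.
  apply (holds_op OpAdd p a b u);
    (reflexivity || apply le_cpair_l || apply le_cpair_2 || apply le_cpair_3).
Qed.

Lemma holds_mul p a b u :
  holds (POp OpMul p) (cpair a (cpair b u)) <-> holds p (cpair (b * a) u).
Proof.
  apply (holds_op OpMul p a b u);
    (reflexivity || apply le_cpair_l || apply le_cpair_2 || apply le_cpair_3).
Qed.

(** As <0, 0> = 0, the code 0 of the empty list behaves like a list of zeros. *)
Lemma enc_split l : enc l = cpair (env l 0) (enc (skipn 1 l)).
Proof. destruct l; [symmetry; apply cpair_00 | reflexivity]. Qed.

Lemma holds_drop p l v :
  holds (POp Drop p) (cpair (enc l) v) <-> holds p (cpair (enc (skipn 1 l)) v).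
Proof.
  rewrite (enc_split l); apply (holds_op Drop p (env l 0) (enc (skipn 1 l)) v);
    [reflexivity | eapply le_trans; apply le_cpair_l | | apply le_cpair_r].
  eapply le_trans; [apply le_cpair_r | apply le_cpair_l].
Qed.

Lemma holds_fetch p l v :
  holds (POp Fetch p) (cpair (enc l) v) <-> holds p (cpair (env l 0) v).
Proof.
  rewrite (enc_split l); apply (holds_op Fetch p (env l 0) (enc (skipn 1 l)) v);
    [reflexivity | eapply le_trans; apply le_cpair_l | | apply le_cpair_r].
  eapply le_trans; [apply le_cpair_r | apply le_cpair_l].
Qed.

Fixpoint lookup (n : nat) (p : prog) : prog :=
  match n with O => POp Fetch p | S n => POp Drop (lookup n p) end.

Lemma holds_lookup (n : nat) p v : forall l,
  holds (lookup n p) (cpair (enc l) v) <-> holds p (cpair (env l n) v).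
Proof.
  induction n; intro l; cbn [lookup]; [apply holds_fetch|].
  rewrite holds_drop, IHn; destruct l; [destruct n|]; reflexivity.
Qed.

(** [k] is the number of intermediate values on top of the assignment. *)
Fixpoint compile_term (k : nat) (t : term) (p : prog) : prog :=
  match t with
  | Var n => POp Copy (lookup (k + n) p)
  | Zero => POp PushZero p
  | One => POp PushOne p
  | Add t u => compile_term k t (compile_term (S k) u (POp OpAdd p))
  | Mul t u => compile_term k t (compile_term (S k) u (POp OpMul p))
  end.

Lemma holds_compile_term t : forall p tmp l,
  holds (compile_term (length tmp) t p) (enc (tmp ++ l)) <->
  holds p (cpair (eval M (env l) t) (enc (tmp ++ l))).
Proof.
  induction t as [n| | |t IHt u IHu|t IHt u IHu]; intros p tmp l;
    cbn [compile_term eval].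
  - rewrite holds_copy, holds_lookup; unfold env at 1.
    rewrite app_nth2_plus; reflexivity.
  - apply holds_zero.
  - apply holds_one.
  - rewrite IHt, (IHu _ (eval M (env l) t :: tmp) l); apply holds_add.
  - rewrite IHt, (IHu _ (eval M (env l) t :: tmp) l); apply holds_mul.
Qed.

Lemma holds_compile_closed t p l :
  holds (compile_term 0 t p) (enc l) <-> holds p (cpair (eval M (env l) t) (enc l)).
Proof. exact (holds_compile_term t p nil l). Qed.

(** [u] is evaluated first, so that the value of [t] ends on top, in the order that [rule_lt]
    expects. *)
Definition compile_rel (t u : term) (p : prog) : prog :=
  compile_term 0 u (compile_term 1 t p).

Lemma holds_compile_rel t u p l :
  holds (compile_rel t u p) (enc l) <->
  holds p (cpair (eval M (env l) t) (cpair (eval M (env l) u) (enc l))).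
Proof.
  unfold compile_rel; rewrite holds_compile_closed.
  apply (holds_compile_term t p (eval M (env l) u :: nil) l).
Qed.

Lemma holds_lt t u l :
  holds (compile_rel t u PLt) (enc l) <-> eval M (env l) t < eval M (env l) u.
Proof.
  rewrite holds_compile_rel; cbn [holds]; unfold rule_lt; split.
  - intros [a [_ [b [_ [v [_ [E H]]]]]]].
    apply cpair_inj in E; destruct E as [-> E].
    apply cpair_inj in E; destruct E as [-> _]; exact H.
  - intro H; eexists; split; [apply le_cpair_l|].
    eexists; split; [apply le_cpair_2|].
    eexists; split; [apply le_cpair_3|]; auto.
Qed.

Lemma holds_le t u l :
  holds (compile_rel t (Add u One) PLt) (enc l) <->
  eval M (env l) t <= eval M (env l) u.
Proof. apply holds_lt. Qed.

Lemma holds_in t l :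
  holds (compile_term 0 t PIn) (enc l) <-> A (eval M (env l) t).
Proof.
  rewrite holds_compile_closed; cbn [holds]; unfold rule_in; split.
  - intros [a [_ [u [_ [E H]]]]].
    apply cpair_inj in E; destruct E as [-> _]; exact H.
  - intro H; eexists; split; [apply le_cpair_l|].
    eexists; split; [apply le_cpair_r|]; auto.
Qed.

Lemma holds_not_in t l :
  holds (compile_term 0 t PNotIn) (enc l) <-> ~ A (eval M (env l) t).
Proof.
  rewrite holds_compile_closed; cbn [holds]; unfold rule_not_in; split.
  - intros [a [_ [u [_ [E H]]]]].
    apply cpair_inj in E; destruct E as [-> _]; exact H.
  - intro H; eexists; split; [apply le_cpair_l|].
    eexists; split; [apply le_cpair_r|]; auto.
Qed.

Lemma holds_all t p l :
  holds (compile_term 0 t (PAll p)) (enc l) <->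
  forall x, x < eval M (env l) t -> holds p (enc (x :: l)).
Proof.
  rewrite holds_compile_closed; cbn [holds]; unfold rule_all; split.
  - intros [b [_ [u [_ [E H]]]]].
    apply cpair_inj in E; destruct E as [<- <-]; exact H.
  - intro H; eexists; split; [apply le_cpair_l|].
    eexists; split; [apply le_cpair_r|]; auto.
Qed.

Lemma holds_ex t p l :
  holds (compile_term 0 t (PEx p)) (enc l) <->
  exists x, x < eval M (env l) t /\ holds p (enc (x :: l)).
Proof.
  rewrite holds_compile_closed; cbn [holds]; unfold rule_ex; split.
  - intros [b [_ [u [_ [E H]]]]].
    apply cpair_inj in E; destruct E as [<- <-]; exact H.
  - intro H; eexists; split; [apply le_cpair_l|].
    eexists; split; [apply le_cpair_r|]; auto.
Qed.

(** As programs have no negation, programs for [f] and for its negation are built together, and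
    [Neg] exchanges them. Equality becomes two inequalities. *)
Lemma compile_formula f : Delta00 f -> exists p p' : prog, forall l,
  (holds p (enc l) <-> sat (Model M (eq A)) (env l) (fun _ => A) f) /\
  (holds p' (enc l) <-> ~ sat (Model M (eq A)) (env l) (fun _ => A) f).
Proof.
  induction 1 as [t u|t u|t X|f _ [p [p' Hp]]|f g _ [p [p' Hp]] _ [q [q' Hq]]
    |f g _ [p [p' Hp]] _ [q [q' Hq]]|f g _ [p [p' Hp]] _ [q [q' Hq]]
    |t f _ [p [p' Hp]]|t f _ [p [p' Hp]]].
  - exists (PAnd (compile_rel t (Add u One) PLt) (compile_rel u (Add t One) PLt)).
    exists (POr (compile_rel t u PLt) (compile_rel u t PLt)); intro l.
    cbn [holds sat]; rewrite !holds_le, !holds_lt; cbn [numbers].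
    generalize (eval M (env l) t), (eval M (env l) u); intros x y; split; split.
    + intros [H H']; apply le_antisym; assumption.
    + intros ->; split; apply le_refl.
    + intros [H|H] ->; exact (lt_irrefl _ H).
    + intro H; destruct (le_or_lt x y) as [L|L]; [|auto].
      apply lt_succ in L; tauto.
  - exists (compile_rel t u PLt), (compile_rel u (Add t One) PLt); intro l.
    rewrite holds_le, holds_lt; cbn [sat numbers].
    split; [tauto|]; split; [|apply not_lt].
    intros H H'; exact (lt_not_le _ _ H' H).
  - exists (compile_term 0 t PIn), (compile_term 0 t PNotIn); intro l.
    rewrite holds_in, holds_not_in; cbn [sat]; tauto.
  - exists p', p; intro l; destruct (Hp l) as [H H']; cbn [sat].
    rewrite H, H'; split; [tauto|]; split; [tauto | apply NNPP].
  - exists (PAnd p q), (POr p' q'); intro l; destruct (Hp l), (Hq l); cbn [sat holds].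
    split; [tauto|]; destruct (classic (holds p (enc l))); tauto.
  - exists (POr p q), (PAnd p' q'); intro l; destruct (Hp l), (Hq l); cbn [sat holds].
    split; tauto.
  - exists (POr p' q), (PAnd p q'); intro l; destruct (Hp l), (Hq l); cbn [sat holds].
    destruct (classic (holds p (enc l))); tauto.
  - exists (compile_term 0 t (PAll p)), (compile_term 0 t (PEx p')); intro l.
    rewrite holds_all, holds_ex; cbn [sat eval]; split.
    + apply forall_iff; intro x; destruct (Hp (x :: l)) as [H _].
      rewrite H, env_cons, eval_tlift; reflexivity.
    + split.
      * intros [x [Hx H]] H'; apply (Hp (x :: l)) in H; apply H; rewrite env_cons.
        apply H'; rewrite eval_tlift; exact Hx.
      * intro H; apply not_all_ex_not in H; destruct H as [x H].
        rewrite eval_tlift in H; exists x; split; [tauto|].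
        apply Hp; rewrite env_cons; tauto.
  - exists (compile_term 0 t (PEx p)), (compile_term 0 t (PAll p')); intro l.
    rewrite holds_all, holds_ex; cbn [sat eval]; split.
    + apply exists_iff; intro x; destruct (Hp (x :: l)) as [H _].
      rewrite H, env_cons, eval_tlift; reflexivity.
    + split.
      * intros H' [x [Hx H]]; rewrite eval_tlift in Hx; apply H' in Hx.
        apply (Hp (x :: l)) in Hx; apply Hx; rewrite env_cons; exact H.
      * intros H x Hx; apply Hp; rewrite env_cons; intro H'; apply H.
        exists x; rewrite eval_tlift; auto.
Qed.

(** * The diagonal sequence *)

(** Stage x enumerates c into the set whose index n = <p, v> consists of the
    code p of a program and the list v of its parameters. *)
Definition certified (n x c : M) : Prop :=
  exists p, p <= n /\ exists v, v <= n /\ n = cpair p v /\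
  exists t, t < x /\ certificate t /\
  exists w, w < x /\ mem t (cpair p (cpair w (cpair c v))).

Definition latest (n x c : M) : Prop :=
  certified n x c /\ forall d, d < x -> c < d -> ~ certified n x d.

(** The recursion clause for R_n(x), where [t] codes R_n below [x]. It fails if nothing below [x]
    has been enumerated by stage [x]. *)
Definition flips (n x t : M) : Prop :=
  exists c, c < x /\ latest n x c /\ ~ mem t c.

Definition solves (n x t : M) : Prop :=
  forall j, j <= x -> (mem t j <-> flips n j t).

Definition diag (n x : M) : Prop := exists t, solves n x t /\ mem t x.

Lemma flips_local n x t t' :
  (forall k, k < x -> mem t k <-> mem t' k) -> flips n x t -> flips n x t'.
Proof.
  intros E [c [Hc [L H]]]; exists c; split; [exact Hc|]; split; [exact L|].
  rewrite <- (E c Hc); exact H.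
Qed.

Lemma solution_exists n x : exists t, solves n x t.
Proof.
  destruct (bounded_recursion (flips n)) with (n := x + one) as [t Ht].
  - intros f g Hf Hg; D.
  - apply flips_local.
  - exists t; intros j Hj; rewrite Ht; tauto.
Qed.

(** The value at [j] depends only on the values below [j], so strong induction applies; its
    predicate is bounded. *)
Lemma solution_unique n x t x' t' : solves n x t -> solves n x' t' ->
  forall j, j <= x -> j <= x' -> (mem t j <-> mem t' j).
Proof.
  intros S S'; apply (strong_induct (fun j => j <= x -> j <= x' -> (mem t j <-> mem t' j))).
  - intros f Hf; D.
  - intros j IH Hx Hx'; rewrite (S j Hx), (S' j Hx').
    assert (E : forall k, k < j -> mem t k <-> mem t' k)
      by (intros k Hk; apply IH; [exact Hk | |]; apply lt_le, (lt_le_trans _ j); assumption).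
    split; apply flips_local; [exact E|].
    intros k Hk; symmetry; exact (E k Hk).
Qed.

(** Hence the value may be read off some solution or off all of them, which gives the Sigma-1 and
    the Pi-1 definition below. *)
Lemma diag_solution n x t : solves n x t -> (diag n x <-> mem t x).
Proof.
  intro S; split; [|exists t; auto].
  intros [t' [S' H]].
  apply (solution_unique n x t x t' S S' x (le_refl x) (le_refl x)); exact H.
Qed.

Lemma diag_latest n x c : c < x -> latest n x c -> (diag n x <-> ~ diag n c).
Proof.
  intros Hc L; destruct (solution_exists n x) as [t S].
  assert (Sc : solves n c t).
  { intros j Hj; apply S, (le_trans _ c); [exact Hj | apply lt_le, Hc]. }
  rewrite (diag_solution _ _ _ S), (diag_solution _ _ _ Sc), (S x (le_refl x)).
  split; [|intro H; exists c; auto].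
  intros [d [Hd [L' H]]]; replace c with d; [exact H|].
  destruct L as [Cc Lc], L' as [Cd Ld].
  apply le_antisym; apply not_lt; intro H'; [apply (Lc d) | apply (Ld c)]; assumption.
Qed.

Definition diag_code (y : M) : Prop := exists n x, y = cpair n x /\ diag n x.

Lemma diag_code_pair n x : diag_code (cpair n x) <-> diag n x.
Proof.
  split; [|exists n, x; auto].
  intros [n' [x' [E H]]]; apply cpair_inj in E; destruct E as [-> ->]; exact H.
Qed.

Lemma diag_code_Delta01 : Delta01_Def M A diag_code.
Proof.
  apply (isD_Delta01_Def M A (fun t y => exists n, n <= y /\ exists x, x <= y /\
    y = cpair n x /\ solves n x t /\ mem t x)
    (fun t y => exists n, n <= y /\ exists x, x <= y /\
    y = cpair n x /\ (solves n x t -> mem t x))); [D | D | |]; intro y; split.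
  - intros [n [x [-> [t [S H]]]]]; exists t.
    exists n; split; [apply le_cpair_l|]; exists x; split; [apply le_cpair_r|]; auto.
  - intros [t [n [_ [x [_ [E [S H]]]]]]]; exists n, x; split; [exact E|].
    exists t; auto.
  - intros [n [x [-> H]]] t.
    exists n; split; [apply le_cpair_l|]; exists x; split; [apply le_cpair_r|].
    split; [reflexivity|]; intro S; apply (diag_solution _ _ _ S), H.
  (* Any instance of the universal quantifier shows that [y] is a pair; the instance at an actual
     solution then decides membership. *)
  - intro H; destruct (H zero) as [n [_ [x [_ [-> _]]]]].
    apply diag_code_pair; destruct (solution_exists n x) as [t S].
    apply (diag_solution _ _ _ S).
    destruct (H t) as [n' [_ [x' [_ [E H']]]]].
    apply cpair_inj in E; destruct E as [<- <-]; auto.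
Qed.

(** The matrix of the Sigma-1 definition is compiled, and the index pairs the code of its program
    with the list of the finitely many relevant parameters. *)
Lemma Delta01_Def_certified C : Delta01_Def M A C -> exists n,
  (forall x c, certified n x c -> C c) /\
  (forall c, C c -> exists x0, forall x, x0 <= x -> certified n x c).
Proof.
  intros [f [_ [rho [[q Hq] [_ [EC _]]]]]].
  destruct (sat_support (Model M (eq A)) q) as [k Hk].
  destruct (compile_formula q Hq) as [p [pn Hp]].
  set (v := enc (map rho (seq 0 k))).
  assert (E : forall c, C c <-> exists w, holds p (cpair w (cpair c v))).
  { intro c; rewrite (EC c); cbn [sat]; apply exists_iff; intro w.
    change (cpair w (cpair c v)) with (enc (w :: c :: map rho (seq 0 k))).
    rewrite (proj1 (Hp _)); apply Hk; intros i Hi.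
    rewrite !env_cons; destruct i as [|[|i]]; try reflexivity; cbn [scons].
    unfold env; rewrite nth_indep with (d' := rho 0)
      by (rewrite length_map, length_seq; lia).
    rewrite map_nth, seq_nth by lia; reflexivity. }
  exists (cpair (pcode p) v); split.
  - intros x c [p' [_ [v' [_ [Ev [t [_ [Ct [w [_ H]]]]]]]]]].
    apply cpair_inj in Ev; destruct Ev as [<- Ev]; subst v'.
    apply E; exists w; apply (certificate_sound t Ct), H.
  - intros c Hc; apply E in Hc; destruct Hc as [w Hw].
    destruct (certificate_exists p (cpair w (cpair c v) + one)) as [t [Ct Ht]].
    (* The stage has to exceed both the certificate and the witness. *)
    exists (t + w + one); intros x Hx.
    exists (pcode p); split; [apply le_cpair_l|].
    exists v; split; [apply le_cpair_r|]; split; [reflexivity|].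
    exists t; split.
    { apply lt_of_succ_le, (le_trans _ (t + w + one)); [|exact Hx].
      apply le_iff; exists w; ring. }
    split; [exact Ct|]; exists w; split; [|apply Ht; [apply le_refl | exact Hw]].
    apply lt_of_succ_le, (le_trans _ (t + w + one)); [|exact Hx].
    apply le_iff; exists t; ring.
Qed.

Lemma diag_changes n C :
  (forall x c, certified n x c -> C c) ->
  (forall c, C c -> exists x0, forall x, x0 <= x -> certified n x c) ->
  (forall b, exists c, b < c /\ C c) ->
  forall b, exists c x, b < c /\ b < x /\ C c /\ C x /\ (diag n x <-> ~ diag n c).
Proof.
  intros sound complete unbounded b.
  destruct (unbounded b) as [c0 [Hb0 Hc0]], (complete c0 Hc0) as [x0 Hx0].
  (* At a stage beyond [x0] the element [c0] has been enumerated, and beyond [c0] it lies below the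
     stage; so a latest element exists and is at least [c0]. *)
  destruct (unbounded (x0 + c0)) as [x [Hx Cx]].
  assert (Hcx : c0 < x) by (apply (le_lt_trans _ (x0 + c0)); [apply le_add_r | exact Hx]).
  destruct (greatest (certified n x) x c0) as [c [Hc [H0 [Hcert Hmax]]]].
  - intros f Hf; D.
  - exact Hcx.
  - apply Hx0, (le_trans _ (x0 + c0)); [apply le_add_l | apply lt_le, Hx].
  - exists c, x; split; [apply (lt_le_trans _ c0); assumption|].
    split; [apply (lt_trans _ c0); assumption|].
    split; [apply (sound _ _ Hcert)|]; split; [exact Cx|].
    apply diag_latest; [exact Hc | split; assumption].
Qed.

End Arithmetic.

Theorem theorem5p4 (M : L1_structure) (A : M -> Prop) :
  models_theory (Model M (Delta01_Def M A)) RCA0star ->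
  models (Model M (Delta01_Def M A)) (Neg COH).
Proof.
  intros RCA rho sigma _ H.
  destruct (H (diag_code M A) (diag_code_Delta01 M A RCA))
    as [C [HC [unbounded cohesive]]].
  destruct (Delta01_Def_certified M A RCA C HC) as [n [sound complete]].
  pose proof (diag_changes M A RCA n C sound complete unbounded) as changes.
  (* In either case column [n] of the coded sequence is constant on [C] above [b], whereas [changes]
     yields two elements of [C] above [b] on which it differs. *)
  destruct (cohesive n) as [[b Hb]|[b Hb]]; cbn in Hb;
    destruct (changes b) as [c [x [Hc [Hx [Cc [Cx E]]]]]];
    rewrite <- !(diag_code_pair M A RCA) in E;
    pose proof (Hb c Hc Cc) as Rc; pose proof (Hb x Hx Cx) as Rx;
    unfold cpair in E; tauto.
Qed.
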